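(* Let $\sigma$ and $\tilde\sigma$ be the surface tensions of the lozenge model and of the four-vertex model, with Newton polygons $N$ and $\tilde N$ respectively, and let $z\in\mathbb{H}$ be the intrinsic coordinate of the lozenge model, with functions $s(z),t(z)$, all as in the context. Then: (i) The map $(s,t)\mapsto(\tilde s,\tilde t)=\left(\frac{s-t}{1+t},\frac{t}{1+t}\right)$ takes $N$ to $\tilde N$, and $$\tilde\sigma(\tilde s,\tilde t)=(1-\tilde t)\,\sigma\!\left(\frac{\tilde s+\tilde t}{1-\tilde t},\frac{\tilde t}{1-\tilde t}\right)=\frac{\sigma(s,t)}{1+t}.$$ (ii) With $\tilde s(z),\tilde t(z)$ obtained from $s(z),t(z)$ by this map, $z$ is an intrinsic coordinate for $\tilde\sigma$, and $$\kappa(z):=\sqrt{\det H_{\tilde\sigma}}=\pi\,(1+t(z))^2,$$ where $H_{\tilde\sigma}$ is the Hessian matrix of $\tilde\sigma$ in the variables $(\tilde s,\tilde t)$, evaluated at $(\tilde s(z),\tilde t(z))$. (iii) $\kappa^{1/2}(z)=\sqrt\pi\,(1+t(z))$ is a harmonic function of $z$; that is, the four-vertex model has the trivial potential property.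
   Context: Fix $r>1$. Four-vertex model: configurations of vertex-disjoint lattice paths in $\mathbb{Z}^2$ with north and east unit steps, in which no vertex is traversed by two consecutive east steps. Thus each vertex is of one of four types: empty (weight $r^2-1$), traversed straight vertically (weight $1$), or one of the two corners north-then-east, east-then-north (weight $r$ each). The weight of a configuration is the product of its vertex weights. Lozenge model: configurations of vertex-disjoint lattice paths in $\mathbb{Z}^2$ with north and east unit steps (equivalently, lozenge tilings), weighted by the product of $1$ for each vertical edge of the paths, $r^2$ for each horizontal edge and $r^2-1$ for each empty vertex. Height functions: in both models the height function $h$ is defined on faces of $\mathbb{Z}^2$, is constant off the paths, decreases by $1$ when crossing a vertical path edge from left to right, and increases by $1$ when crossing a horizontal path edge upwards. The possible average slopes $(\partial_xh,\partial_yh)$ form the Newton polygons, the closed triangles $$N=\mathrm{conv}\{(0,0),(-1,0),(0,1)\}\ \text{(lozenge)},\qquad \tilde N=\mathrm{conv}\{(0,0),(-1,0),(-\tfrac12,\tfrac12)\}\ \text{(four-vertex)}.$$ Surface tension: for each model the surface tension at a slope $(a,b)$ in the interior of its Newton polygon is $-\lim_{n\to\infty}\frac1{n^2}\log Z_n$, where $Z_n$ is the total weight of configurations on the $n\times n$ torus with horizontal and vertical height changes $(k_n,l_n)$ satisfying $(k_n,l_n)/n\to(a,b)$; it is extended continuously to the closed polygon and is $+\infty$ outside. Intrinsic coordinate: for a smooth strictly convex $\sigma(s,t)$ on the interior of its Newton polygon, an intrinsic coordinate is a conformal (isothermal) coordinate for the Riemannian metric $\sigma_{ss}\,ds^2+2\sigma_{st}\,ds\,dt+\sigma_{tt}\,dt^2$.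 The surface tension has the trivial potential property if $\sqrt\kappa$ is a harmonic function of the intrinsic coordinate, where $\kappa=\sqrt{\det H_\sigma}$ and $H_\sigma$ is the Hessian matrix of $\sigma$ in the slope variables. Known representation of the lozenge model: the interior of $N$ is parameterized diffeomorphically by an intrinsic coordinate $z$ in the upper half plane $\mathbb{H}$, such that $s(z),t(z)$ and $(X(z),Y(z)):=\nabla\sigma(s(z),t(z))$ are harmonic functions of $z$ and $$X_z+i\pi t_z=0,\qquad Y_z-i\pi s_z=0,$$ where the subscript $z$ denotes $\partial/\partial z$ (Wirtinger derivative). *)

(* Defs.v *)
From mathcomp Require Import all_boot all_order all_algebra.
From mathcomp Require Import all_classical all_reals all_analysis.
From mathcomp Require Import complex.
Import Order.TTheory GRing.Theory Num.Theory.
Import numFieldNormedType.Exports.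

Set Implicit Arguments.
Unset Strict Implicit.
Unset Printing Implicit Defensive.

Local Open Scope classical_set_scope.
Local Open Scope ring_scope.

(* A set of edges of the n x n torus.  (c v).1 says that the edge going east
   out of the vertex v is in the set, (c v).2 that the edge going north out of
   v is.  Coordinates are (x, y), with x increasing eastwards. *)
Definition config (n : nat) : finType :=
  {ffun 'I_n * 'I_n -> bool * bool}.

Section Config.
Context {n : nat}.
Implicit Types (c : config n) (v : 'I_n * 'I_n).

Definition edge_east c v : bool := (c v).1.
Definition edge_north c v : bool := (c v).2.
Definition edge_west c v : bool := (c (ord_pred v.1, v.2)).1.
Definition edge_south c v : bool := (c (v.1, ord_pred v.2)).2.

Definition empty_vertex c v : bool :=
  [&& ~~ edge_east c v, ~~ edge_north c v, ~~ edge_west c v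
    & ~~ edge_south c v].

(* Disjoint north-east paths: each vertex is either unused, or entered once
   (from the west or the south) and left once (to the east or the north). *)
Definition path_config c : bool :=
  [forall v, (edge_west c v + edge_south c v == edge_east c v + edge_north c v)%N
             && (edge_east c v + edge_north c v <= 1)%N].

Definition four_vertex_config c : bool :=
  path_config c && [forall v, ~~ (edge_west c v && edge_east c v)].

(* Increments of the height function h, which is multivalued on the torus:
   across the vertical edge from v to v + (0,1), from left to right, and across
   the horizontal edge from v to v + (1,0), upwards. *)
Definition dhx c v : int := - (edge_north c v)%:Z.
Definition dhy c v : int := (edge_east c v)%:Z.

(* Total changes of h around the horizontal and the vertical loops of faces. *)
Definition height_change c (k l : int) : bool :=
  [forall y : 'I_n, \sum_(x < n) dhx c (x, y) == k]
  && [forall x : 'I_n, \sum_(y < n) dhy c (x, y) == l].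

End Config.

Section Models.
Context {R : realType}.
Variable r : R.

(* Only meaningful for four-vertex configurations, where the last case is that
   of the two corners. *)
Definition four_vertex_vertex_weight n (c : config n) (v : 'I_n * 'I_n) : R :=
  if empty_vertex c v then r ^+ 2 - 1
  else if edge_south c v && edge_north c v then 1
  else r.

(* Each edge is charged to the vertex it goes out of. *)
Definition lozenge_vertex_weight n (c : config n) (v : 'I_n * 'I_n) : R :=
  (if edge_north c v then 1 else 1)
  * (if edge_east c v then r ^+ 2 else 1)
  * (if empty_vertex c v then r ^+ 2 - 1 else 1).

Definition Z_four_vertex (n : nat) (k l : int) : R :=
  \sum_(c : config n | four_vertex_config c && height_change c k l)
    \prod_v four_vertex_vertex_weight c v.

Definition Z_lozenge (n : nat) (k l : int) : R :=
  \sum_(c : config n | path_config c && height_change c k l)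
    \prod_v lozenge_vertex_weight c v.

End Models.

Section SurfaceTension.
Context {R : realType}.

Definition triangle (a b c : R * R) : set (R * R) :=
  [set p | exists u v w : R,
     [/\ 0 <= u, 0 <= v, 0 <= w, u + v + w = 1
       & p = u *: a + v *: b + w *: c]].

Definition newton_lozenge : set (R * R) := triangle (0, 0) (-1, 0) (0, 1).

Definition newton_four_vertex : set (R * R) :=
  triangle (0, 0) (-1, 0) (- 2^-1, 2^-1).

(* sigma is the surface tension of the model with torus partition functions
   Z n k l and Newton polygon N. *)
Definition is_surface_tension (Z : nat -> int -> int -> R) (N : set (R * R))
    (sigma : R * R -> \bar R) : Prop :=
  [/\ forall (p : R * R) (k l : nat -> int), N° p ->
        (k n)%:~R / n%:R @[n --> \oo] --> p.1 ->
        (l n)%:~R / n%:R @[n --> \oo] --> p.2 ->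
        (- (ln (Z n (k n) (l n)) / n%:R ^+ 2))%:E @[n --> \oo] --> sigma p,
      forall p, N p -> sigma p \is a fin_num,
      {within N, continuous sigma}
    & forall p, ~ N p -> sigma p = +oo%E].

End SurfaceTension.

Section Calculus.
Context {R : realType}.
Implicit Types (U V : set (R * R)) (f : R * R -> R) (p : R * R).

Definition pd1 f : R * R -> R := fun p => 'D_(1, 0) f p.
Definition pd2 f : R * R -> R := fun p => 'D_(0, 1) f p.

(* f is of class C^k on the open set U *)
Fixpoint Ck_on (k : nat) U f : Prop :=
  if k is k'.+1 then
    [/\ forall p, U p -> differentiable f p, Ck_on k' U (pd1 f)
      & Ck_on k' U (pd2 f)]
  else forall p, U p -> {for p, continuous f}.

Definition smooth_on U f : Prop := forall k, Ck_on k U f.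

Definition smooth_map_on U (F : R * R -> R * R) : Prop :=
  smooth_on U (fst \o F) /\ smooth_on U (snd \o F).

Definition diffeomorphism U V (F : R * R -> R * R) : Prop :=
  exists G : R * R -> R * R,
    [/\ smooth_map_on U F, smooth_map_on V G,
        set_fun U V F, set_fun V U G
      & {in U, cancel F G} /\ {in V, cancel G F}].

Definition strictly_convex_on U f : Prop :=
  forall (p q : R * R) (u : R), U p -> U q -> p != q -> 0 < u -> u < 1 ->
    f (u *: p + (1 - u) *: q) < u * f p + (1 - u) * f q.

Definition harmonic_on U f : Prop :=
  Ck_on 2 U f /\ forall p, U p -> pd1 (pd1 f) p + pd2 (pd2 f) p = 0.

(* The point (x, y) of the plane stands for the complex number x + iy. *)
Definition upper_half_plane : set (R * R) := [set p | 0 < p.2].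

Local Open Scope complex_scope.

Definition wirtinger f p : R[i] :=
  2%:R^-1 * ((pd1 f p)%:C - 'i%C * (pd2 f p)%:C).

Definition hessian f p : 'M[R]_2 :=
  \matrix_(i < 2, j < 2)
    let d (m : 'I_2) := if m == 0 then pd1 else pd2 in d j (d i f) p.

(* The symmetric bilinear form of f_ss ds^2 + 2 f_st ds dt + f_tt dt^2. *)
Definition hessian_metric f p (u v : R * R) : R :=
  pd1 (pd1 f) p * u.1 * v.1
  + pd2 (pd1 f) p * (u.1 * v.2 + u.2 * v.1)
  + pd2 (pd2 f) p * u.2 * v.2.

(* The metric pulled back by F is a positive multiple of dx^2 + dy^2 on U. *)
Definition conformal_on U f (F : R * R -> R * R) : Prop :=
  forall z, U z ->
    let Fx := (pd1 (fst \o F) z, pd1 (snd \o F) z) in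
    let Fy := (pd2 (fst \o F) z, pd2 (snd \o F) z) in
    exists lambda : R,
      [/\ 0 < lambda, hessian_metric f (F z) Fx Fx = lambda,
          hessian_metric f (F z) Fy Fy = lambda
        & hessian_metric f (F z) Fx Fy = 0].

(* The inverse of F : D -> interior of N is a (global) intrinsic coordinate
   for f, that is F z is the slope of intrinsic coordinate z. *)
Definition intrinsic_coordinate (N : set (R * R)) f (D : set (R * R))
    (F : R * R -> R * R) : Prop :=
  [/\ smooth_on N° f, strictly_convex_on N° f, open D,
      diffeomorphism D N° F & conformal_on D f F].

Definition kappa f p : R := Num.sqrt (\det (hessian f p)).

(* Harmonicity is invariant under conformal changes of coordinate, so the
   choice of the intrinsic coordinate is immaterial. *)
Definition trivial_potential (N : set (R * R)) f : Prop :=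
  exists (D : set (R * R)) (F : R * R -> R * R),
    intrinsic_coordinate N f D F
    /\ harmonic_on D (fun z => Num.sqrt (kappa f (F z))).

End Calculus.

Definition slope_map {R : realType} (p : R * R) : R * R :=
  ((p.1 - p.2) / (1 + p.2), p.2 / (1 + p.2)).

(* Main.v *)
Require Import Defs.
From mathcomp Require Import all_boot all_order all_algebra.
From mathcomp Require Import all_classical all_reals all_analysis.
From mathcomp Require Import complex.
From mathcomp Require Import zify ring lra.
Import Order.TTheory GRing.Theory Num.Theory.
Import numFieldNormedType.Exports.

Set Implicit Arguments.
Unset Strict Implicit.
Unset Printing Implicit Defensive.

Local Open Scope classical_set_scope.
Local Open Scope ring_scope.

(* Stretching the lozenge model column by column, (x, y) |-> (x, y + h + x) where
   h is the height function, turns its configurations into those of the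
   four-vertex model: every horizontal edge gains a vertical edge after it.  The
   weight of a configuration on a torus only depends on the height changes, and
   is preserved.  The square torus becomes a skew one, which is repaired by
   gluing: tori of side n with equal boundary conditions (there are 4 ^ n of
   these) can be assembled freely on the quotient by any sublattice, in
   particular on one whose image under the stretching is a square torus.  The
   same works backwards, hence sigma' (slope_map p) = sigma p / (1 + t) at
   rational slopes, and everywhere by continuity.

   So sigma' is the perspective function (1 - t') sigma ((s' + t') / (1 - t'),
   t' / (1 - t')); its Hessian form is that of sigma, pulled back and divided by
   1 + t.  Therefore z stays conformal, and det H_sigma' = (1 + t)^4 det H_sigma,
   where det H_sigma = pi^2 by the Cauchy-Riemann relations. *)

(** * Height functions of periodic configurations *)

(** Heights on the plane, rather than configurations on a torus, carry the argument: the shift by h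
    + x does not preserve a given torus, but it acts on every quasi-periodic height and sends a
    period (a, b) with change k to (a, b + k + a), from which the sublattices are computed. The
    shift skips faces of a column and so has no inverse map; it is recorded as a Galois connection
    between y and v, which determines either height from the other and turns each local condition
    into linear inequalities between integers. Gluing loses a factor 4 ^ n per cell, by pigeonhole
    on the boundary conditions; this is n log 4 on a scale of n^2. The partition functions are
    therefore compared by two opposite inequalities, each from a torus of side of order n to one of
    side of order n^2, and only the limits agree. Both limits are taken along height changes exactly
    proportional to the side, whence the rational slopes. *)

Lemma addzAC (x y z : int) : x + y + z = x + z + y.
Proof. exact: addrAC. Qed.

(** The equivalence carries a property in both directions along the integers; it spreads relations
    between translates of a height from one point to a line. *)
Lemma int_shift_ind (P : int -> Prop) :
  P 0 -> (forall x : int, P x <-> P (x + 1)) -> forall x : int, P x.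
Proof.
move=> P0 PS; elim/int_rect => // n Pn.
  by move/PS: Pn; rewrite -PoszD addn1.
by apply/PS; rewrite (_ : _ + 1 = - n%:Z) //; lia.
Qed.

Definition int_primitive (a : int -> int) (x : int) : int :=
  match x with
  | Posz n => \sum_(i < n) a i%:Z
  | Negz n => - \sum_(i < n.+1) a (- (i.+1)%:Z)
  end.

Lemma int_primitiveD1 a (x : int) : int_primitive a (x + 1) = int_primitive a x + a x.
Proof.
case: x => [n|[|n]].
- by rewrite -PoszD addn1 /= big_ord_recr.
- by rewrite /= big_ord_recr !big_ord0 /= add0r addNr.
rewrite (_ : Negz n.+1 + 1 = Negz n); last by lia.
rewrite /= [in RHS]big_ord_recr /= opprD -addrA NegzE addNr addr0 //.
Qed.

Lemma int_primitive0 a : int_primitive a 0 = 0.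
Proof. by rewrite /= big_ord0. Qed.

Lemma telescope_int (f : int -> int) (n : nat) :
  \sum_(i < n) (f (i%:Z + 1) - f i%:Z) = f n%:Z - f 0.
Proof.
elim: n => [|n IHn]; first by rewrite big_ord0 subrr.
by rewrite big_ord_recr /= IHn -PoszD addn1; ring.
Qed.

Lemma eq_int_diff (f g : int -> int) : f 0 = g 0 ->
  (forall x : int, f (x + 1) - f x = g (x + 1) - g x) -> f =1 g.
Proof.
move=> fg0 fgS; apply: int_shift_ind => // x.
by have := fgS x; split; lia.
Qed.

Section Residue.
Variable n : nat.

Definition zord (x : int) : 'I_n.+1 := inord `|(x %% n.+1)%Z|.

Lemma zordE (q x : int) (i : 'I_n.+1) : x = i%:Z + q * n.+1%:Z -> zord x = i.
Proof.
move=> ->; have iP : 0 <= i%:Z < n.+1%:Z by have := ltn_ord i; lia.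
by rewrite /zord addrC modzMDl modz_small // absz_nat inord_val.
Qed.

Lemma zord_divz (x : int) :
 x = (zord x)%:Z + (x %/ n.+1)%Z * n.+1%:Z.
Proof.
rewrite {1}(divz_eq x n.+1) addrC; congr (_ + _).
have lt0 : (0 <= (x %% n.+1)%Z) by rewrite modz_ge0.
have ltn : ((x %% n.+1)%Z < n.+1%:Z) by rewrite ltz_pmod.
by rewrite /zord inordK; lia.
Qed.

Lemma zord_ord (i : 'I_n.+1) : zord i%:Z = i.
Proof. by apply: (@zordE 0); ring. Qed.

Lemma zordMD (q x : int) : zord (x + q * n.+1%:Z) = zord x.
Proof.
by apply: (@zordE (q + (x %/ n.+1)%Z)); rewrite {1}(zord_divz x); ring.
Qed.

Lemma zordD (x : int) : zord (x + n.+1%:Z) = zord x.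
Proof. by rewrite -{1}[n.+1%:Z]mul1r zordMD. Qed.

Lemma zord_pred (x : int) : ord_pred (zord x) = zord (x - 1).
Proof.
have [i0|i0] := posnP (zord x).
  apply/esym/(@zordE ((x %/ n.+1)%Z - 1)).
  rewrite {1}(zord_divz x) /= !i0 add0n modn_small //.
  by move: (x %/ _)%Z => q; lia.
apply/esym/(@zordE (x %/ n.+1)%Z).
rewrite {1}(zord_divz x) /=; move: (zord x) i0 => [i /= lti] i0.
rewrite (_ : (i + n.+1).-1 = i.-1 + n.+1)%N ?modnDr ?modn_small; lia.
Qed.

End Residue.

Definition height := int -> int -> int.

(* A height is a function on the faces of Z^2, indexed so that the face (x, y)
   is the one south-west of the vertex (x, y). *)
Definition lozenge_height (h : height) : Prop :=
  forall x y : int, [/\ 0 <= h x (y + 1) - h x y <= 1,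
    0 <= h x y - h (x + 1) y <= 1
    & 0 <= h x (y + 1) - h (x + 1) y <= 1].

(** The two vertical differences are the west and the east edge of the vertex (x, y), which may not
    both be present. *)
Definition fv_height (h : height) : Prop :=
  lozenge_height h /\
  forall x y : int, (h x (y + 1) - h x y) + (h (x + 1) (y + 1) - h (x + 1) y) <= 1.

Definition quasiperiod (h : height) (a b k : int) : Prop :=
  forall x y : int, h (x + a) (y + b) = h x y + k.

Definition torus_height n (h : height) (k l : int) : Prop :=
  quasiperiod h n.+1 0 k /\ quasiperiod h 0 n.+1 l.

Definition config_of_height n (h : height) : config n.+1 :=
  [ffun v : 'I_n.+1 * 'I_n.+1 => (h (v.1%:Z + 1) (v.2%:Z + 1) - h (v.1%:Z + 1) v.2%:Z == 1,
              h v.1%:Z (v.2%:Z + 1) - h (v.1%:Z + 1) (v.2%:Z + 1) == 1)].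

Lemma quasiperiodM h (a b k m : int) :
  quasiperiod h a b k -> quasiperiod h (m * a) (m * b) (m * k).
Proof.
move=> hp; elim/int_shift_ind: m => [x y|m]; first by rewrite !mul0r !addr0.
split=> hm x y.
  have := hm x y; have := hp (x + m * a) (y + m * b).
  rewrite !mulrDl !mul1r !addrA => -> ->; ring.
have := hm x y; have := hp (x + m * a) (y + m * b).
rewrite !mulrDl !mul1r !addrA => -> /addIr ->; ring.
Qed.

Lemma torus_heightM n h (k l i j x y : int) : torus_height n h k l ->
  h (x + i * n.+1%:Z) (y + j * n.+1%:Z) = h x y + i * k + j * l.
Proof.
move=> [hk hl]; have := quasiperiodM i hk x (y + j * n.+1%:Z).
have := quasiperiodM j hl x y.
by rewrite !mulr0 !addr0 => -> ->; ring.
Qed.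

Section ConfigOfHeight.
Variables (n : nat) (h : height) (k l : int).
Hypothesis hT : torus_height n h k l.
Let c := config_of_height n h.

Lemma edge_east_height (x y : int) : edge_east c (zord n x, zord n y) =
  (h (x + 1) (y + 1) - h (x + 1) y == 1).
Proof.
rewrite /edge_east ffunE /=.
rewrite [in RHS](zord_divz n x) [in RHS](zord_divz n y).
rewrite ![in RHS](addrAC _ _ 1) !(torus_heightM _ _ _ _ hT).
by congr (_ == _); ring.
Qed.

Lemma edge_north_height (x y : int) : edge_north c (zord n x, zord n y) =
  (h x (y + 1) - h (x + 1) (y + 1) == 1).
Proof.
rewrite /edge_north ffunE /=.
rewrite [in RHS](zord_divz n x) [in RHS](zord_divz n y).
rewrite ![in RHS](addrAC _ _ 1) !(torus_heightM _ _ _ _ hT).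
by congr (_ == _); ring.
Qed.

Lemma edge_west_height (x y : int) : edge_west c (zord n x, zord n y) =
  (h x (y + 1) - h x y == 1).
Proof.
have := edge_east_height (x - 1) y; rewrite subrK => <-.
by rewrite /edge_west /edge_east /= zord_pred.
Qed.

Lemma edge_south_height (x y : int) : edge_south c (zord n x, zord n y) =
  (h x y - h (x + 1) y == 1).
Proof.
have := edge_north_height x (y - 1); rewrite subrK => <-.
by rewrite /edge_south /edge_north /= zord_pred.
Qed.

Lemma vertex_zord (v : 'I_n.+1 * 'I_n.+1) : v = (zord n v.1%:Z, zord n v.2%:Z).
Proof. by case: v => i j /=; rewrite !zord_ord. Qed.

Lemma path_config_of_height : lozenge_height h -> path_config c.
Proof.
move=> hL; apply/forallP => v; rewrite (vertex_zord v).
move: (v.1%:Z) (v.2%:Z) => x y.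
rewrite edge_east_height edge_north_height edge_west_height edge_south_height.
by have := hL x y; have := hL (x + 1) y; have := hL x (y + 1) => -[]+ + + []+ + + [];lia.
Qed.

Lemma four_vertex_config_of_height : fv_height h -> four_vertex_config c.
Proof.
move=> [hL hF]; rewrite /four_vertex_config path_config_of_height //=.
apply/forallP => v; rewrite (vertex_zord v).
move: (v.1%:Z) (v.2%:Z) => x y.
rewrite edge_east_height edge_west_height.
by have := hF x y; lia.
Qed.

Lemma height_change_of_height : lozenge_height h -> height_change c k l.
Proof.
move=> hL; apply/andP; split; apply/forallP => z; apply/eqP.
  have hk := hT.1 0 (z%:Z + 1); rewrite add0r addr0 in hk.
  rewrite (_ : k = h n.+1%:Z (z%:Z + 1) - h 0 (z%:Z + 1)); last by rewrite hk; ring.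
  rewrite -(telescope_int (fun x => h x (z%:Z + 1))); apply: eq_bigr => i _.
  rewrite /dhx (vertex_zord (i, z)) edge_north_height /=.
  by have [_ + _] := hL i%:Z (z%:Z + 1); lia.
have hl := hT.2 (z%:Z + 1) 0; rewrite add0r addr0 in hl.
rewrite (_ : l = h (z%:Z + 1) n.+1%:Z - h (z%:Z + 1) 0); last by rewrite hl; ring.
rewrite -(telescope_int (h (z%:Z + 1))); apply: eq_bigr => i _.
rewrite /dhy (vertex_zord (z, i)) edge_east_height /=.
by have [+ _ _] := hL (z%:Z + 1) i%:Z; lia.
Qed.

End ConfigOfHeight.

Section HeightOfConfig.
Variables (n : nat) (c : config n.+1).

Definition zedge (e : config n.+1 -> 'I_n.+1 * 'I_n.+1 -> bool) (x y : int) : int :=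
  (e c (zord n x, zord n y))%:Z.

(** Integrates the increments along row 0, then up the column x. Independence of the path is
    [height_of_dx]. *)
Definition height_of : height := fun x y =>
  int_primitive (fun i => - zedge edge_south i 0) x
  + int_primitive (zedge edge_west x) y.

Hypothesis cP : path_config c.

Lemma zedge_west (x y : int) : zedge edge_west x y = zedge edge_east (x - 1) y.
Proof. by rewrite /zedge /edge_west zord_pred. Qed.

Lemma zedge_south (x y : int) : zedge edge_south x y = zedge edge_north x (y - 1).
Proof. by rewrite /zedge /edge_south zord_pred. Qed.

Lemma zedge_closed (x y : int) :
  zedge edge_west x y + zedge edge_south x y
    = zedge edge_east x y + zedge edge_north x y /\
  zedge edge_east x y + zedge edge_north x y <= 1.
Proof.
have /andP[/eqP] := forallP cP (zord n x, zord n y).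
by rewrite /zedge; lia.
Qed.

Lemma height_of_dy (x y : int) : height_of x (y + 1) - height_of x y = zedge edge_west x y.
Proof. by rewrite /height_of int_primitiveD1; ring. Qed.

(** Conservation of paths at a vertex says that the increments around it are closed, so the formula,
    true by construction on row 0, spreads to all rows. *)
Lemma height_of_dx (x y : int) : height_of (x + 1) y - height_of x y = - zedge edge_south x y.
Proof.
move: y; apply: eq_int_diff => [|y].
  by rewrite /height_of !int_primitive0 int_primitiveD1; ring.
transitivity ((height_of (x + 1) (y + 1) - height_of (x + 1) y)
  - (height_of x (y + 1) - height_of x y)); first by ring.
rewrite !height_of_dy; have [] := zedge_closed x y.
by rewrite /= (zedge_west (x + 1)) (zedge_south x (y + 1)) !addrK; lia.
Qed.

Lemma lozenge_height_of : lozenge_height height_of.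
Proof.
move=> x y; have := height_of_dy x y; have := height_of_dx x y.
have [] := zedge_closed x y.
by rewrite /zedge; split; lia.
Qed.

(** The increments are periodic, so the difference between the height and its translate by the side
    is constant along the direction of translation; at 0 it telescopes to the height change of that
    row or column. *)
Lemma torus_height_of (k l : int) : height_change c k l -> torus_height n height_of k l.
Proof.
move=> /andP[/forallP ck /forallP cl]; split=> x y; rewrite addr0.
  apply/eqP; rewrite -subr_eq0 opprD addrA subr_eq0; apply/eqP.
  elim/int_shift_ind: x => [|x].
    rewrite add0r -(telescope_int (height_of^~ y)).
    rewrite -(eqP (ck (zord n (y - 1)))); apply: eq_bigr => i _.
    by rewrite height_of_dx zedge_south /zedge /dhx zord_ord.
  have := height_of_dx x y; have := height_of_dx (x + n.+1%:Z) y.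
  rewrite (_ : zedge _ (_ + _) _ = zedge edge_south x y); last by rewrite /zedge zordD.
  by rewrite (addzAC x n.+1%:Z 1); split; lia.
apply/eqP; rewrite -subr_eq0 opprD addrA subr_eq0; apply/eqP.
elim/int_shift_ind: y => [|y].
  rewrite add0r -(telescope_int (height_of x)).
  rewrite -(eqP (cl (zord n (x - 1)))); apply: eq_bigr => i _.
  by rewrite height_of_dy zedge_west /zedge /dhy zord_ord.
have := height_of_dy x y; have := height_of_dy x (y + n.+1%:Z).
rewrite (_ : zedge _ _ (_ + _) = zedge edge_west x y); last by rewrite /zedge zordD.
by rewrite (addzAC y n.+1%:Z 1); split; lia.
Qed.

Lemma height_ofK : config_of_height n height_of = c.
Proof.
apply/ffunP => -[i j]; rewrite ffunE /= height_of_dy.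
rewrite (_ : height_of i (j%:Z + 1) - _ = zedge edge_south i (j%:Z + 1)).
  rewrite zedge_west zedge_south !addrK /zedge !zord_ord /edge_east /edge_north.
  by case: (c (i, j)) => -[] [].
by have := height_of_dx i (j%:Z + 1); lia.
Qed.

End HeightOfConfig.

Lemma fv_height_of n (c : config n.+1) :
  four_vertex_config c -> fv_height (height_of c).
Proof.
move=> /andP[cP /forallP cF]; split; first exact: lozenge_height_of.
move=> x y; rewrite !height_of_dy (zedge_west c (x + 1)) addrK.
by have := cF (zord n x, zord n y); rewrite /zedge; lia.
Qed.

(** * Gluing and stretching heights *)

Lemma divz_shift n (q z : int) :
  ((z + q * n.+1%:Z) %/ n.+1)%Z = (z %/ n.+1)%Z + q.
Proof. by rewrite addrC divzMDl // addrC. Qed.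

Section Glue.
Variables (n : nat) (k l : int) (hh : int -> int -> height).

Hypothesis hhT : forall i j : int, torus_height n (hh i j) k l.
Hypothesis agree_x : forall (i j i' j' x : int), hh i j x 0 = hh i' j' x 0.
Hypothesis agree_y : forall (i j i' j' y : int), hh i j 0 y = hh i' j' 0 y.

(** Each cell uses its own height at the global coordinates: all of them share the changes k and l
    and the values on the axes, so neighbouring cells match with no additive correction. *)
Definition glue : height := fun x y => hh (x %/ n.+1)%Z (y %/ n.+1)%Z x y.

(* Since the heights agree on the boundary of the cells, the formula of a cell
   remains valid on its closure. *)
Lemma glueE (i j x y : int) : i * n.+1%:Z <= x <= i * n.+1%:Z + n.+1%:Z ->
  j * n.+1%:Z <= y <= j * n.+1%:Z + n.+1%:Z -> glue x y = hh i j x y.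
Proof.
move=> xi yj; rewrite /glue.
have agx (q i' j' u v : int) : u = q * n.+1%:Z -> hh i j u v = hh i' j' u v.
  move=> ->; have := torus_heightM q 0 0 v (hhT i j).
  have := torus_heightM q 0 0 v (hhT i' j').
  by rewrite (agree_y i j i' j' v) !add0r !mul0r !addr0 => -> ->.
have agy (q i' j' u v : int) : v = q * n.+1%:Z -> hh i j u v = hh i' j' u v.
  move=> ->; have := torus_heightM 0 q u 0 (hhT i j).
  have := torus_heightM 0 q u 0 (hhT i' j').
  by rewrite (agree_x i j i' j' u) !add0r !mul0r !addr0 => -> ->.
have divE (q z : int) : q * n.+1%:Z < z < q * n.+1%:Z + n.+1%:Z -> (z %/ n.+1)%Z = q.
  move=> qz; have mz : 0 <= z - q * n.+1%:Z < n.+1%:Z by lia.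
  by rewrite -(subrK (q * n.+1%:Z) z) divz_shift divz_small ?add0r.
have [x0|x0] := eqVneq x (i * n.+1%:Z); first by rewrite -(agx i).
have [x1|x1] := eqVneq x (i * n.+1%:Z + n.+1%:Z).
  by rewrite -(agx (i + 1)) // x1 mulrDl mul1r.
have [y0|y0] := eqVneq y (j * n.+1%:Z); first by rewrite -(agy j).
have [y1|y1] := eqVneq y (j * n.+1%:Z + n.+1%:Z).
  by rewrite -(agy (j + 1)) // y1 mulrDl mul1r.
by rewrite (divE i) ?(divE j) //; lia.
Qed.

(** Any two by two block of faces lies in one closed cell, and the local conditions on heights only
    involve such blocks. *)
Lemma glue_block (x y : int) : exists i j : int,
  [/\ glue x y = hh i j x y, glue (x + 1) y = hh i j (x + 1) y,
      glue x (y + 1) = hh i j x (y + 1)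
    & glue (x + 1) (y + 1) = hh i j (x + 1) (y + 1)].
Proof.
exists (x %/ n.+1)%Z, (y %/ n.+1)%Z.
have cell z : (z %/ n.+1)%Z * n.+1%:Z <= z /\ z < (z %/ n.+1)%Z * n.+1%:Z + n.+1%:Z.
  have := zord_divz n z; have := ltn_ord (zord n z).
  by move: (zord n z : nat) (z %/ n.+1)%Z => u q; lia.
have := cell x; have := cell y.
by split; apply: glueE; lia.
Qed.

Lemma glue_lozenge : (forall i j : int, lozenge_height (hh i j)) -> lozenge_height glue.
Proof.
move=> hL x y; have [i [j [-> -> -> _]]] := glue_block x y; exact: hL.
Qed.

Lemma glue_fv : (forall i j : int, fv_height (hh i j)) -> fv_height glue.
Proof.
move=> hF; split; first by apply: glue_lozenge => i j; case: (hF i j).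
move=> x y; have [i [j [-> -> -> ->]]] := glue_block x y.
by have [_] := hF i j; apply.
Qed.

Lemma glue_quasiperiod (a d : int) :
  (forall i j : int, hh (i + a) (j + d) = hh i j) ->
  quasiperiod glue (a * n.+1%:Z) (d * n.+1%:Z) (a * k + d * l).
Proof.
move=> hp x y; rewrite /glue !divz_shift hp.
by rewrite (torus_heightM _ _ _ _ (hhT _ _)) addrA.
Qed.

End Glue.

(** A translation by multiples of the side brings any face into the cell (i, j) and changes both
    heights of that cell by the same amount. *)
Lemma glue_inj n (k l : int) (hh1 hh2 : int -> int -> height) :
  (forall i j : int, torus_height n (hh1 i j) k l) ->
  (forall i j : int, torus_height n (hh2 i j) k l) ->
  (forall x y : int, glue n hh1 x y = glue n hh2 x y) ->
  forall i j x y, hh1 i j x y = hh2 i j x y.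
Proof.
move=> h1 h2 e i j x y.
set p := i - (x %/ n.+1)%Z; set q := j - (y %/ n.+1)%Z.
have := e (x + p * n.+1%:Z) (y + q * n.+1%:Z); rewrite /glue.
rewrite !divz_shift !subrKC.
rewrite (torus_heightM _ _ _ _ (h1 i j)) (torus_heightM _ _ _ _ (h2 i j)).
by move=> /addIr/addIr.
Qed.

Lemma eq_int_le (a b : int) : (forall y : int, (y <= a) = (y <= b)) -> a = b.
Proof. by move=> ab; have := ab a; have := ab b; lia. Qed.

Lemma eq_int_ge (a b : int) : (forall y : int, (a <= y) = (b <= y)) -> a = b.
Proof. by move=> ab; have := ab a; have := ab b; lia. Qed.

(* The surface of height [h] over the faces (x, y) is the surface of height
   [h'] over the faces (x, y + h + x): column by column, y |-> y + h x y + x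
   and v |-> v - x - h' x v are adjoint. *)
Definition dual (h h' : height) : Prop :=
  forall x y v : int, (y <= v - x - h' x v) = (y + h x y + x <= v).

Section Dual.
Variables (h h' : height).
Hypothesis hh' : dual h h'.

Lemma dual_fv : lozenge_height h -> fv_height h'.
Proof.
move=> hL.
(* Put g(x, v) = v - x - h'(x, v). The claims [gS], [gX] and [gXS] are the three conditions of
   [lozenge_height h'] in terms of g; [gD] and the lower bound in [gXS] give the four-vertex
   condition. *)
have gS (x v : int) : (v - x - h' x v <= (v + 1) - x - h' x (v + 1))
    /\ ((v + 1) - x - h' x (v + 1) <= v - x - h' x v + 1).
  split; first by rewrite hh'; have := hh' x (v - x - h' x v) v; lia.
  set g := v - x - h' x v; set g1 := v + 1 - x - h' x (v + 1).
  have := hh' x (g1 - 1) v; have := hh' x g1 (v + 1).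
  by have [+ _ _] := hL x (g1 - 1); rewrite subrK -/g -/g1; lia.
have gX (x v : int) : (v - (x + 1) - h' (x + 1) v <= v - x - h' x v)
    /\ (v - x - h' x v - 1 <= v - (x + 1) - h' (x + 1) v).
  split.
    set g := v - (x + 1) - h' (x + 1) v; rewrite hh'.
    have := hh' (x + 1) g v; have [_ + _] := hL x g.
    by rewrite -/g; lia.
  set g := v - x - h' x v; rewrite hh'.
  have := hh' x g v; have [_ _] := hL x (g - 1).
  by rewrite subrK -/g; lia.
have gXS (x v : int) : (v - (x + 1) - h' (x + 1) v + 1 <= (v + 1) - x - h' x (v + 1))
    /\ ((v + 1) - x - h' x (v + 1) - 2 <= v - (x + 1) - h' (x + 1) v).
  split.
    set g := v - (x + 1) - h' (x + 1) v; rewrite hh'.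
    have := hh' (x + 1) g v; have [_ _] := hL x g.
    by rewrite -/g; lia.
  set g := v + 1 - x - h' x (v + 1); rewrite hh'.
  have := hh' x g (v + 1); have [_ _] := hL x (g - 2).
  have [+ _ _] := hL x (g - 2 + 1).
  by rewrite (_ : g - 2 + 1 + 1 = g) -/g; lia.
have gD (x v : int) : v - x - h' x v <= (v + 1) - (x + 1) - h' (x + 1) (v + 1).
  set g := v - x - h' x v; rewrite hh'.
  by have := hh' x g v; have [_ + _] := hL x g; rewrite -/g; lia.
split=> x v; have := gS x v; have := gX x v; have := gXS x v; have := gD x v;
  have := gS (x + 1) v; [split; lia|lia].
Qed.

(** In a four-vertex configuration a horizontal edge is followed by a vertical one, so no horizontal
    edge sits directly above another. Hence y + h x y + x advances by at most 2 when y advances by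
    1, which bounds the vertical step of h by 1. *)
Lemma dual_lozenge : fv_height h' -> lozenge_height h.
Proof.
move=> [hL hF] x y; split.
- have := hh' x (y + 1) (y + 1 + h x (y + 1) + x).
  have := hh' x y (y + 1 + h x (y + 1) + x - 1).
  have [] := hL x (y + 1 + h x (y + 1) + x - 1); rewrite subrK.
  have := hh' x y (y + h x y + x).
  have := hh' x (y + 1) (y + h x y + x + 1 + 1).
  have := hL x (y + h x y + x) => -[].
  have := hL x (y + h x y + x + 1) => -[].
  have := hF x (y + h x y + x).
  by lia.
- have := hh' (x + 1) y (y + h (x + 1) y + (x + 1)).
  have := hh' x y (y + h (x + 1) y + (x + 1)).
  have [_ + _] := hL x (y + h (x + 1) y + (x + 1)).
  have := hh' x y (y + h x y + x).
  have := hh' (x + 1) y (y + h x y + x + 1).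
  have := hL x (y + h x y + x) => -[].
  have := hL x (y + h x y + x + 1) => -[].
  have := hF x (y + h x y + x).
  by lia.
have := hh' x (y + 1) (y + 1 + h x (y + 1) + x).
have := hh' (x + 1) y (y + 1 + h x (y + 1) + x).
have [_ + _] := hL x (y + 1 + h x (y + 1) + x).
have := hh' (x + 1) y (y + h (x + 1) y + (x + 1)).
have := hh' x (y + 1) (y + h (x + 1) y + (x + 1) + 1).
have [_ _] := hL x (y + h (x + 1) y + (x + 1)).
by lia.
Qed.

(** Translating (x, y) by (a, b) changes h by k, hence moves y + h x y + x by b + k + a. *)
Lemma dual_quasiperiod (a b k : int) :
  quasiperiod h a b k -> quasiperiod h' a (b + k + a) k.
Proof.
move=> hp x v.
suff : v + (b + k + a) - (x + a) - h' (x + a) (v + (b + k + a))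
       = v - x - h' x v + b by lia.
apply: eq_int_le => y; rewrite hh'.
have -> : (y <= v - x - h' x v + b) = (y - b <= v - x - h' x v) by lia.
by rewrite hh'; have := hp x (y - b); rewrite subrK => ->; lia.
Qed.

Lemma dual_quasiperiod_inv (a b k : int) :
  quasiperiod h' a b k -> quasiperiod h a (b - k - a) k.
Proof.
move=> hp x y.
suff : y + (b - k - a) + h (x + a) (y + (b - k - a)) + (x + a)
       = y + h x y + x + b by lia.
apply: eq_int_ge => v; rewrite -hh'.
have -> : (y + h x y + x + b <= v) = (y + h x y + x <= v - b) by lia.
by rewrite -hh'; have := hp x (v - b); rewrite subrK => ->; lia.
Qed.

End Dual.

Lemma dual_detr h1 h1' h2 h2' (x : int) : dual h1 h1' -> dual h2 h2' ->
  h1 x =1 h2 x -> h1' x =1 h2' x.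
Proof.
move=> d1 d2 e v; suff : v - x - h1' x v = v - x - h2' x v by lia.
by apply: eq_int_le => y; rewrite d1 d2 e.
Qed.

Lemma dual_detl h1 h1' h2 h2' (x : int) : dual h1 h1' -> dual h2 h2' ->
  h1' x =1 h2' x -> h1 x =1 h2 x.
Proof.
move=> d1 d2 e y; suff : y + h1 x y + x = y + h2 x y + x by lia.
by apply: eq_int_ge => v; rewrite -d1 -d2 e.
Qed.

Lemma int_nondecreasing (f : int -> int) : (forall y : int, f y <= f (y + 1)) ->
  forall y z : int, y <= z -> f y <= f z.
Proof.
move=> fS y z yz; rewrite (_ : z = y + `|z - y|%N%:Z); last by lia.
elim: (absz _) => [|m IHm]; first by rewrite addr0.
by apply: (le_trans IHm); rewrite (_ : y + m.+1%:Z = y + m%:Z + 1) //; lia.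
Qed.

Lemma int_strict_growth (f : int -> int) : (forall y : int, f y + 1 <= f (y + 1)) ->
  forall v : int, (exists y, v < f y) /\ (exists y, f y <= v).
Proof.
move=> fS v.
have fm (m : nat) : f 0 + m%:Z <= f m%:Z /\ f (- m%:Z) <= f 0 - m%:Z.
  elim: m => [|m [IH1 IH2]]; first by rewrite oppr0 addr0.
  have := fS m%:Z; have := fS (- m.+1%:Z).
  rewrite (_ : - m.+1%:Z + 1 = - m%:Z); last by lia.
  by rewrite (_ : m%:Z + 1 = m.+1%:Z); lia.
have [] := fm (absz (v - f 0)).+1; move: (f 0) fm => f0 _.
by split; [exists (absz (v - f0)).+1%:Z|exists (- (absz (v - f0)).+1%:Z)]; lia.
Qed.

(** g(v) is the greatest y with f(y) <= v; it exists because f is monotone and unbounded in both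
    directions. *)
Lemma int_adjoint (f : int -> int) : (forall y : int, f y <= f (y + 1)) ->
  (forall v : int, (exists y, v < f y) /\ (exists y, f y <= v)) ->
  exists g : int -> int, forall y v : int, (y <= g v) = (f y <= v).
Proof.
move=> fS fu.
have fH := int_nondecreasing fS.
suff /choice[g gP] : forall v : int, exists y, f y <= v < f (y + 1).
  exists g => y v; have /andP[g1 g2] := gP v.
  apply/idP/idP => [/fH/le_trans|yv]; first exact.
  rewrite leNgt; apply/negP => gy.
  have := fH (g v + 1) y; lia.
move=> v; have [[y1 fy1] [y0 fy0]] := fu v.
have y01 : y0 < y1.
  by rewrite ltNge; apply/negP => /fH; lia.
have ex : exists m : nat, v < f (y0 + m%:Z).
  by exists `|y1 - y0|%N; rewrite (_ : y0 + _ = y1) //; lia.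
case: (ex_minnP ex) => -[|m]; first by rewrite addr0; lia.
move=> fm mmin; exists (y0 + m%:Z).
rewrite (_ : y0 + m%:Z + 1 = y0 + m.+1%:Z) ?fm ?andbT; last by lia.
by rewrite leNgt; apply/negP => /mmin; rewrite ltnn.
Qed.

(** The reflection v |-> - v exchanges lower and upper adjoints. *)
Lemma int_adjoint_inv (g : int -> int) : (forall v : int, g v <= g (v + 1)) ->
  (forall v : int, (exists y, v < g y) /\ (exists y, g y <= v)) ->
  exists f : int -> int, forall y v : int, (y <= g v) = (f y <= v).
Proof.
move=> gS gu; have [v|v|F FP] := @int_adjoint (fun v => - g (- v)).
- by rewrite lerN2; have := gS (- (v + 1)); rewrite (_ : - (v + 1) + 1 = - v) //; lia.
- have [_ [y1 gy1]] := gu (- v - 1); have [[y0 gy0] _] := gu (- v - 1).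
  by split; [exists (- y1)|exists (- y0)]; rewrite opprK; lia.
exists (fun y => - F (- y)) => y v; have := FP (- v) (- y).
by rewrite opprK; lia.
Qed.

Lemma dual_exists h : lozenge_height h -> exists h', dual h h'.
Proof.
move=> hL.
suff /choice[g gP] : forall x : int, exists g : int -> int,
    forall y v : int, (y <= g v) = (y + h x y + x <= v).
  by exists (fun x v => v - x - g x v) => x y v; rewrite -gP; lia.
move=> x; apply: int_adjoint => [y|].
  by have [+ _ _] := hL x y; lia.
apply: int_strict_growth => y.
by have [+ _ _] := hL x y; lia.
Qed.

Lemma dual_exists_inv h' : fv_height h' -> exists h, dual h h'.
Proof.
move=> [hL hF].
suff /choice[f fP] : forall x : int, exists f : int -> int,
    forall y v : int, (y <= v - x - h' x v) = (f y <= v).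
  by exists (fun x y => f x y - y - x) => x y v; rewrite fP; lia.
move=> x; apply: (int_adjoint_inv (g := fun v => v - x - h' x v)) => [v|v].
  by have [+ _ _] := hL x v; lia.
(* Two consecutive vertical differences of h' in a column cannot both be 1, so v - x - h' x v is
   only sure to grow over two steps, hence the doubled argument. *)
have [y|[y1 gy1] [y0 gy0]] := int_strict_growth (f := fun z => (z + z) - x - h' x (z + z)) _ v.
  have := hL x (y + y) => -[]; have := hL x (y + y + 1) => -[].
  rewrite (_ : y + 1 + (y + 1) = y + y + 1 + 1); last by lia.
  by have := hF x (y + y); lia.
by split; [exists (y1 + y1)|exists (y0 + y0)].
Qed.

(** * Comparison of the partition functions *)

(** A stretched configuration is only known to exist, through a dual height, so the injection is
    given as a relation and the function is chosen here. *)
Lemma card_le_rel (T U : finType) (A : {pred T}) (B : {pred U})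
    (Rel : T -> U -> Prop) :
  (forall x, x \in A -> exists2 y, y \in B & Rel x y) ->
  (forall x x' y, x \in A -> x' \in A -> Rel x y -> Rel x' y -> x = x') ->
  (#|A| <= #|B|)%N.
Proof.
move=> ex inj.
have /choice[g gP] : forall x : {x | x \in A}, exists y, y \in B /\ Rel (val x) y.
  by move=> [x xA]; have [y yB Rxy] := ex x xA; exists y.
have gI : injective g.
  move=> x y e; apply: val_inj; have [_ Rx] := gP x; have [_ Ry] := gP y.
  by apply: (inj _ _ (g x)); rewrite ?(valP x) ?(valP y) // e.
have := card_sig (mem A); rewrite -(card_codom gI) => <-.
by apply/subset_leq_card/fintype.subsetP => _ /codomP[x ->]; have [] := gP x.
Qed.

(** Pigeonhole: S is the largest fibre of f in A. *)
Lemma card_fiber_ge (T U : finType) (f : T -> U) (A : {set T}) :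
  exists2 S : {set T}, S \subset A /\ {in S &, forall x y, f x = f y}
    & (#|A| <= #|U| * #|S|)%N.
Proof.
have [->|[x0 _]] := set_0Vmem A.
  by exists finset.set0; rewrite ?sub0set ?cards0 //; split => // x y; rewrite inE.
pose F u := [set x in A | f x == u]%SET.
pose u1 := [arg max_(u > f x0) #|F u|].
have u1P u : (#|F u| <= #|F u1|)%N.
  by rewrite /u1; case: arg_maxnP => // v _ vP; apply: vP.
exists (F u1); first split.
- by apply/fintype.subsetP => x; rewrite inE => /andP[].
- by move=> x y; rewrite !inE => /andP[_ /eqP->] /andP[_ /eqP->].
rewrite -sum1_card (partition_big f predT) //=.
rewrite -sum_nat_const; apply: leq_sum => u _.
by apply: leq_trans (u1P u); rewrite -sum1_card; under [leqRHS]eq_bigl do rewrite inE.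
Qed.

(** The edges across the bottom and left sides of the torus cut open: the data that determine the
    height on the two axes, where glued cells have to agree. *)
Definition boundary n (c : config n.+1) :=
  ([ffun x => edge_south c (x, ord0)], [ffun y => edge_west c (ord0, y)]).

Lemma card_boundary n :
  #|{: {ffun 'I_n.+1 -> bool} * {ffun 'I_n.+1 -> bool}}| = (4 ^ n.+1)%N.
Proof. by rewrite card_prod !card_ffun card_ord card_bool -expnMn. Qed.

Lemma boundary_height_x n (c c' : config n.+1) : boundary c = boundary c' ->
  forall x : int, height_of c x 0 = height_of c' x 0.
Proof.
move=> [/ffunP ex _] x; rewrite /height_of !int_primitive0 !addr0.
congr int_primitive; apply/funext => i; rewrite /zedge.
have z0 : zord n 0 = ord0 by apply: (@zordE n 0); rewrite mul0r.
by have := ex (zord n i); rewrite !ffunE z0 => ->.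
Qed.

Lemma boundary_height_y n (c c' : config n.+1) : boundary c = boundary c' ->
  forall y : int, height_of c 0 y = height_of c' 0 y.
Proof.
move=> [_ /ffunP ey] y; rewrite /height_of !int_primitive0 !add0r.
congr int_primitive; apply/funext => i; rewrite /zedge.
have z0 : zord n 0 = ord0 by apply: (@zordE n 0); rewrite mul0r.
by have := ey (zord n i); rewrite !ffunE z0 => ->.
Qed.

(** A configuration determines the increments of its height, hence the height up to a constant. *)
Lemma eq_height n (h1 h2 : height) (k l k' l' : int) :
  torus_height n h1 k l -> torus_height n h2 k' l' ->
  lozenge_height h1 -> lozenge_height h2 ->
  config_of_height n h1 = config_of_height n h2 -> h1 0 0 = h2 0 0 ->
  forall x y, h1 x y = h2 x y.
Proof.
move=> T1 T2 L1 L2 e e0 x; apply: eq_int_diff.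
  move: x; apply: eq_int_diff => // x.
  have [_ + _] := L1 x 0; have [_ + _] := L2 x 0.
  by have := edge_south_height T1 x 0; rewrite e (edge_south_height T2); lia.
move=> y; have [+ _ _] := L1 x y; have [+ _ _] := L2 x y.
by have := edge_west_height T1 x y; rewrite e (edge_west_height T2); lia.
Qed.

(** * Assembling cells on a quotient of the plane *)

Section Families.
Variables (n a b : nat) (k l d : int) (S : {set config n.+1}).
Hypothesis SP : {in S, forall c, path_config c && height_change c k l}.
Hypothesis SB : {in S &, forall c c', boundary c = boundary c'}.

(* The cell (i, j) of the plane, on the quotient by (a.+1, d) and (0, b.+1). *)
Definition cell (i j : int) : 'I_a.+1 * 'I_b.+1 :=
  (zord a i, zord b (j - d * (i %/ a.+1)%Z)).

Definition family_height (f : {ffun 'I_a.+1 * 'I_b.+1 -> config n.+1}) : height :=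
  glue n (fun i j => height_of (f (cell i j))).

Section OneFamily.
Variable f : {ffun 'I_a.+1 * 'I_b.+1 -> config n.+1}.
Hypothesis fS : f \in ffun_on (mem S).

Let fP v : path_config (f v) && height_change (f v) k l.
Proof. by apply: SP; apply: (ffun_onP fS). Qed.

Let fT i j : torus_height n (height_of (f (cell i j))) k l.
Proof. by have /andP[? ?] := fP (cell i j); apply: torus_height_of. Qed.

Let fB v v' : boundary (f v) = boundary (f v').
Proof. by apply: SB; apply: (ffun_onP fS). Qed.

Lemma family_lozenge : lozenge_height (family_height f).
Proof.
apply: (glue_lozenge fT) => [i j i' j'|i j i' j'|i j].
- exact: boundary_height_x.
- exact: boundary_height_y.
by apply: lozenge_height_of; case/andP: (fP (cell i j)).
Qed.

Lemma family_fv : {in S, forall c, four_vertex_config c} -> fv_height (family_height f).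
Proof.
move=> SF; apply: (glue_fv fT) => [i j i' j'|i j i' j'|i j].
- exact: boundary_height_x.
- exact: boundary_height_y.
by apply: fv_height_of; apply: SF; apply: (ffun_onP fS).
Qed.

(** Moving by [a.+1] columns of cells raises the quotient of i by one, which the shift of j by d
    compensates in [cell]. *)
Lemma family_quasiperiod_x : quasiperiod (family_height f)
  (a.+1%:Z * n.+1%:Z) (d * n.+1%:Z) (a.+1%:Z * k + d * l).
Proof.
apply: (glue_quasiperiod fT) => i j; rewrite /cell zordD.
have := divz_shift a 1 i; rewrite mul1r => ->.
by rewrite mulrDr mulr1 opprD addrACA subrr addr0.
Qed.

Lemma family_quasiperiod_y : quasiperiod (family_height f)
  0 (b.+1%:Z * n.+1%:Z) (b.+1%:Z * l).
Proof.
have := @glue_quasiperiod n k l _ fT 0 b.+1%:Z; rewrite !mul0r add0r; apply.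
by move=> i j; rewrite /cell addr0 addzAC zordD.
Qed.

Lemma family_height_x0 c : c \in S -> family_height f 0 =1 height_of c 0.
Proof.
move=> cS y; apply: boundary_height_y; apply: SB => //.
exact: (ffun_onP fS).
Qed.

End OneFamily.

Lemma family_height_inj f g : f \in ffun_on (mem S) -> g \in ffun_on (mem S) ->
  (forall x y, family_height f x y = family_height g x y) -> f = g.
Proof.
have hT h : h \in ffun_on (mem S) -> forall i j,
    torus_height n (height_of (h (cell i j))) k l.
  move=> hS i j; have /SP/andP[hp hc] := ffun_onP hS (cell i j).
  exact: torus_height_of.
move=> fS gS e; apply/ffunP => -[i j].
have /SP/andP[fp _] := ffun_onP fS (i, j).
have /SP/andP[gp _] := ffun_onP gS (i, j).
have := glue_inj (hT f fS) (hT g gS) e i%:Z j%:Z.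
have -> : cell i%:Z j%:Z = (i, j).
  have i0 : (i%:Z %/ a.+1)%Z = 0 by apply: divz_small; have := ltn_ord i; lia.
  by rewrite /cell i0 mulr0 subr0 !zord_ord.
move=> fg; rewrite -(height_ofK fp) -(height_ofK gp); congr config_of_height.
by apply/funext => x; apply/funext.
Qed.

End Families.

Section Counting.
Variables (n m : nat) (l : nat) (k : int).

Lemma card_four_vertex_ge : (m.+1 = n.+1 * (n.+1 + l))%N ->
  exists2 s, (#|[set c : config n.+1 | path_config c && height_change c k l]%SET|
              <= 4 ^ n.+1 * s)%N
  & (s ^ m.+1 <= #|[set c : config m.+1 | four_vertex_config c &&
       height_change c (n.+1%:Z * (k - l%:Z)) (n.+1%:Z * l%:Z)]%SET|)%N.
Proof.
move=> mE; set A := [set c | _]%SET.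
have [S [SA SB]] := card_fiber_ge (@boundary n) A.
rewrite card_boundary => AS; exists #|S| => //.
have SP : {in S, forall c, path_config c && height_change c k l}.
  by move=> c /(fintype.subsetP SA); rewrite inE.
have -> : (#|S| ^ m.+1 = #|@ ffun_on ('I_(n + l).+1 * 'I_n.+1)%type (mem S)|)%N.
  by rewrite card_ffun_on card_prod !card_ord mE mulnC addSn.
(* With N = [n.+1], cells are taken modulo (N + l, -(N + k)) and (0, N), which leaves [m.+1] of
   them. Along N times these vectors the glued height changes by N (k - l) and N l, and the
   stretching turns them into (m + 1, 0) and (0, m + 1). *)
pose H := @family_height n (n + l) n (- (n.+1%:Z + k)).
pose Rel f (c : config m.+1) := exists2 h', dual (H f) h' &
  torus_height m h' (n.+1%:Z * (k - l%:Z)) (n.+1%:Z * l%:Z) /\ c = config_of_height m h'.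
have HL f : f \in ffun_on (mem S) -> lozenge_height (H f).
  by move=> fS; apply: family_lozenge SP SB _ fS.
apply: (@card_le_rel _ _ _ _ Rel) => [f fS|f g c fS gS [h1 d1 [T1 ->]] [h2 d2 [T2 e]]].
  have [h' d'] := dual_exists (HL f fS).
  have T' : torus_height m h' (n.+1%:Z * (k - l%:Z)) (n.+1%:Z * l%:Z).
    split.
      have := dual_quasiperiod d' (family_quasiperiod_x (- (n.+1%:Z + k)) SP fS).
      congr quasiperiod; nia.
    have := dual_quasiperiod d' (family_quasiperiod_y (- (n.+1%:Z + k)) SP fS).
    congr quasiperiod; nia.
  exists (config_of_height m h'); last by exists h'.
  have F' := dual_fv d' (HL f fS).
  rewrite inE (four_vertex_config_of_height T' F').
  by rewrite (height_change_of_height T') //; case: F'.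
apply: (family_height_inj SP fS gS) => x y; apply: (dual_detl d1 d2) => {y} y.
have [L1 _] := dual_fv d1 (HL f fS); have [L2 _] := dual_fv d2 (HL g gS).
apply: (eq_height T1 T2 L1 L2 e).
(* The configuration leaves an additive constant free; it is fixed on column 0, where all families
   coincide because their cells share one boundary. *)
apply: (dual_detr d1 d2) => y0.
have cS := ffun_onP fS (ord0, ord0).
by rewrite /H (family_height_x0 _ SB fS cS) (family_height_x0 _ SB gS cS).
Qed.

Lemma card_lozenge_ge : (l < n.+1)%N -> (m.+1 = n.+1 * (n.+1 - l))%N ->
  exists2 s, (#|[set c : config n.+1 | four_vertex_config c && height_change c k l]%SET|
              <= 4 ^ n.+1 * s)%N
  & (s ^ m.+1 <= #|[set c : config m.+1 | path_config c &&
       height_change c (n.+1%:Z * (k + l%:Z)) (n.+1%:Z * l%:Z)]%SET|)%N.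
Proof.
move=> ln mE; set A := [set c | _]%SET.
have [S [SA SB]] := card_fiber_ge (@boundary n) A.
rewrite card_boundary => AS; exists #|S| => //.
have SP : {in S, forall c, path_config c && height_change c k l}.
  by move=> c /(fintype.subsetP SA); rewrite inE => /andP[/andP[-> _] ->].
have SF : {in S, forall c, four_vertex_config c}.
  by move=> c /(fintype.subsetP SA); rewrite inE => /andP[].
have nZ : (n - l).+1%:Z = n.+1%:Z - l%:Z by lia.
have mZ : m.+1%:Z = n.+1%:Z * (n.+1%:Z - l%:Z) by rewrite mE PoszM -nZ subSn.
have -> : (#|S| ^ m.+1 = #|@ ffun_on ('I_(n - l).+1 * 'I_n.+1)%type (mem S)|)%N.
  by rewrite card_ffun_on card_prod !card_ord mE mulnC subSn.
(* Backwards, a period (a, b) with change k becomes (a, b - k - a). With N = [n.+1], the vectors (N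
   - l, N + k) and (0, N), multiplied by N, are sent to (m + 1, 0) and (0, m + 1). *)
pose H := @family_height n (n - l) n (n.+1%:Z + k).
pose Rel f (c : config m.+1) := exists2 h, dual h (H f) &
  torus_height m h (n.+1%:Z * (k + l%:Z)) (n.+1%:Z * l%:Z) /\ c = config_of_height m h.
have HF f : f \in ffun_on (mem S) -> fv_height (H f).
  by move=> fS; apply: family_fv SP SB _ fS SF.
apply: (@card_le_rel _ _ _ _ Rel) => [f fS|f g c fS gS [h1 d1 [T1 ->]] [h2 d2 [T2 e]]].
  have [h d'] := dual_exists_inv (HF f fS).
  have T' : torus_height m h (n.+1%:Z * (k + l%:Z)) (n.+1%:Z * l%:Z).
    split.
      have := dual_quasiperiod_inv d' (family_quasiperiod_x (n.+1%:Z + k) SP fS).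
      by congr quasiperiod; rewrite nZ ?mZ; ring.
    have := dual_quasiperiod_inv d' (family_quasiperiod_y (n.+1%:Z + k) SP fS).
    by congr quasiperiod; rewrite ?mZ; ring.
  exists (config_of_height m h); last by exists h.
  have L' := dual_lozenge d' (HF f fS).
  by rewrite inE (path_config_of_height T' L') (height_change_of_height T').
apply: (family_height_inj SP fS gS) => x y; apply: (dual_detr d1 d2) => {y} y.
have L1 := dual_lozenge d1 (HF f fS); have L2 := dual_lozenge d2 (HF g gS).
apply: (eq_height T1 T2 L1 L2 e).
apply: (dual_detl d1 d2) => y0.
have cS := ffun_onP fS (ord0, ord0).
by rewrite /H (family_height_x0 _ SB fS cS) (family_height_x0 _ SB gS cS).
Qed.

End Counting.

(** * Weight of a configuration in terms of its height changes *)

Section EdgeCounts.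
Variables (n : nat) (c : config n.+1) (k l : int).
Hypotheses (cP : path_config c) (ck : height_change c k l).

Lemma sum_edge_east : \sum_v (edge_east c v)%:Z = n.+1%:Z * l.
Proof.
transitivity (\sum_(i < n.+1) \sum_(j < n.+1) (edge_east c (i, j))%:Z).
  by rewrite pair_bigA; apply: eq_bigr => -[].
have /andP[_ /forallP cl] := ck.
under eq_bigr => i _ do rewrite (eqP (cl i)).
by rewrite sumr_const card_ord -mulr_natl natz.
Qed.

Lemma sum_edge_north : \sum_v (edge_north c v)%:Z = - (n.+1%:Z * k).
Proof.
transitivity (\sum_(i < n.+1) \sum_(j < n.+1) (edge_north c (i, j))%:Z).
  by rewrite pair_bigA; apply: eq_bigr => -[].
rewrite exchange_big /=; have
 /andP[/forallP ckk _] := ck.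
have E i : \sum_(j < n.+1) (edge_north c (j, i))%:Z = - k.
  by rewrite -(eqP (ckk i)) -sumrN; apply: eq_bigr => j _; rewrite opprK.
under eq_bigr => i _ do rewrite E.
by rewrite sumr_const card_ord -mulr_natl natz mulrN.
Qed.

Lemma sum_edge_west : \sum_v (edge_west c v)%:Z = n.+1%:Z * l.
Proof.
rewrite -sum_edge_east.
pose p (v : 'I_n.+1 * 'I_n.+1) := (ord_pred v.1, v.2).
pose q (v : 'I_n.+1 * 'I_n.+1) := (ordS v.1, v.2).
rewrite [RHS](reindex p) //; exists q => -[i j] _; rewrite /p /q /=.
  by rewrite ord_predK.
by rewrite ordSK.
Qed.

(** A vertex is left by exactly one edge unless it is empty. *)
Lemma sum_empty_vertex :
  \sum_v (empty_vertex c v)%:Z = n.+1%:Z * (n.+1%:Z - l + k).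
Proof.
transitivity (\sum_v (1 - (edge_east c v)%:Z - (edge_north c v)%:Z)).
  apply: eq_bigr => v _; have /andP[/eqP] := forallP cP v.
  by rewrite /empty_vertex; lia.
rewrite !sumrB sum_edge_east sum_edge_north sumr_const card_prod card_ord.
by rewrite -mulr_natl natz PoszM; ring.
Qed.

End EdgeCounts.

Lemma sum_nat_int (T : finType) (F : T -> nat) (s : int) :
  \sum_i (F i)%:Z = s -> (\sum_i F i)%N = absz s.
Proof.
move=> <-; rewrite -[LHS]absz_nat -natz natr_sum; congr absz.
by apply: eq_bigr => i _; rewrite natz.
Qed.

Section TorusWeight.
Context {R : realType}.
Variable r : R.

(** For height changes realised by a configuration, the exponents are its numbers of horizontal
    edges and of empty vertices. *)
Definition torus_weight (n : nat) (k l : int) : R :=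
  (r ^+ 2) ^+ absz (n%:Z * l) * (r ^+ 2 - 1) ^+ absz (n%:Z * (n%:Z - l + k)).

Lemma lozenge_weight n (c : config n.+1) (k l : int) :
  path_config c -> height_change c k l ->
  \prod_v lozenge_vertex_weight r c v = torus_weight n.+1 k l.
Proof.
move=> cP ck; rewrite /torus_weight.
rewrite -(sum_nat_int (sum_edge_east ck)) -(sum_nat_int (sum_empty_vertex cP ck)).
rewrite -!prodrXr -big_split /=; apply: eq_bigr => v _.
rewrite /lozenge_vertex_weight if_same mul1r.
by case: (edge_east c v); case: (empty_vertex c v); rewrite ?expr0 ?expr1.
Qed.

(* In the four-vertex model the two ends of a horizontal edge are corners. *)
Lemma four_vertex_weight n (c : config n.+1) (k l : int) :
  four_vertex_config c -> height_change c k l ->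
  \prod_v four_vertex_vertex_weight r c v = torus_weight n.+1 k l.
Proof.
move=> /andP[cP /forallP cF] ck; rewrite /torus_weight exprAC expr2.
rewrite -[X in X * _ * _](congr1 (GRing.exp r) (sum_nat_int (sum_edge_east ck))).
rewrite -[X in _ * X * _](congr1 (GRing.exp r) (sum_nat_int (sum_edge_west ck))).
rewrite -(sum_nat_int (sum_empty_vertex cP ck)).
rewrite -!prodrXr -!big_split /=; apply: eq_bigr => v _.
have /andP[/eqP] := forallP cP v; have := cF v.
rewrite /four_vertex_vertex_weight /empty_vertex.
case: (edge_east c v); case: (edge_west c v); case: (edge_north c v);
  by case: (edge_south c v) => //= _ _ _; rewrite ?expr0 ?expr1 ?mul1r ?mulr1.
Qed.

Lemma Z_lozengeE n (k l : int) : Z_lozenge r n.+1 k l =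
  #|[set c : config n.+1 | path_config c && height_change c k l]%SET|%:R
  * torus_weight n.+1 k l.
Proof.
rewrite mulr_natl -sumr_const; apply: eq_big => c; first by rewrite inE.
by move=> /andP[]; apply: lozenge_weight.
Qed.

Lemma Z_four_vertexE n (k l : int) : Z_four_vertex r n.+1 k l =
  #|[set c : config n.+1 | four_vertex_config c && height_change c k l]%SET|%:R
  * torus_weight n.+1 k l.
Proof.
rewrite mulr_natl -sumr_const; apply: eq_big => c; first by rewrite inE.
by move=> /andP[]; apply: four_vertex_weight.
Qed.

Hypothesis r1 : 1 < r.

Lemma torus_weight_gt0 n (k l : int) : 0 < torus_weight n k l.
Proof.
by apply: mulr_gt0; rewrite exprn_gt0 // ?exprn_gt0 ?subr_gt0 ?exprn_egt1 //; apply: lt_trans r1.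
Qed.

(** The large torus, of side m, receives m cells of side n. Horizontal edges agree in total, m n l
    in either count; the hypothesis says the same of empty vertices, after division by m. *)
Lemma torus_weightX n m (k k' l : int) :
  m%:Z - n%:Z * l + k' = n%:Z * (n%:Z - l + k) ->
  torus_weight n k l ^+ m = torus_weight m k' (n%:Z * l).
Proof.
move=> e; rewrite /torus_weight e exprMn -!exprM.
by congr (_ ^+ _ * _ ^+ _); rewrite [in RHS]abszM absz_nat; ring.
Qed.

(** W and V count configurations on the small and on the large torus, of common weights w and w'; s
    counts those of the small torus with one chosen boundary. *)
Lemma count_le_Z (W V s n m : nat) (w w' : R) : 0 < w -> w ^+ m = w' ->
  (W <= 4 ^ n * s)%N -> (s ^ m <= V)%N ->
  (W%:R * w / 4 ^+ n) ^+ m <= V%:R * w'.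
Proof.
move=> w0 <- Ws sV.
have : (W%:R * w / 4 ^+ n) ^+ m <= (s%:R * w) ^+ m.
  rewrite lerXn2r ?nnegrE ?divr_ge0 ?mulr_ge0 ?exprn_ge0 ?ler0n ?(ltW w0) //.
  rewrite ler_pdivrMr ?exprn_gt0 // mulrAC ler_wpM2r ?(ltW w0) //.
  by rewrite -natrX -natrM ler_nat mulnC.
move=> /le_trans; apply; rewrite exprMn ler_wpM2r ?exprn_ge0 ?(ltW w0) //.
by rewrite -natrX ler_nat.
Qed.

Lemma Z_four_vertex_ge n m (k : int) (l : nat) : m = (n.+1 * (n.+1 + l))%N ->
  (Z_lozenge r n.+1 k l%:Z / 4 ^+ n.+1) ^+ m
  <= Z_four_vertex r m (n.+1%:Z * (k - l%:Z)) (n.+1%:Z * l%:Z).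
Proof.
case: m => [|m] mE; first by move: mE; rewrite addSn mulnS.
rewrite Z_lozengeE Z_four_vertexE; have [s Ws sV] := card_four_vertex_ge k mE.
apply: count_le_Z Ws sV; first exact: torus_weight_gt0.
by apply: torus_weightX; rewrite mE PoszM PoszD; ring.
Qed.

Lemma Z_lozenge_ge n m (k : int) (l : nat) : (l < n.+1)%N ->
  m = (n.+1 * (n.+1 - l))%N ->
  (Z_four_vertex r n.+1 k l%:Z / 4 ^+ n.+1) ^+ m
  <= Z_lozenge r m (n.+1%:Z * (k + l%:Z)) (n.+1%:Z * l%:Z).
Proof.
move=> ln; case: m => [|m] mE; first by move: mE; rewrite subSn ?mulnS.
rewrite Z_lozengeE Z_four_vertexE; have [s Ws sV] := card_lozenge_ge k ln mE.
apply: count_le_Z Ws sV; first exact: torus_weight_gt0.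
by apply: torus_weightX; rewrite mE PoszM -subzn ?(ltnW ln) //; ring.
Qed.

(* Witness that the partition functions do not vanish, which is needed because
   [ln 0 = 0]. *)
Definition linear_height n (k l : int) : height :=
  fun x y => ((k * x + l * y) %/ n.+1)%Z.

Lemma linear_torus_height n (k l : int) : torus_height n (linear_height n k l) k l.
Proof.
split=> x y; rewrite /linear_height addr0 -divz_shift; congr (_ %/ _)%Z; ring.
Qed.

Lemma divz_diff n (u v : int) : 0 <= v - u <= n.+1%:Z ->
  0 <= (v %/ n.+1)%Z - (u %/ n.+1)%Z <= 1.
Proof.
have := zord_divz n u; have := zord_divz n v.
have := ltn_ord (zord n u); have := ltn_ord (zord n v).
move: (zord n u : nat) (zord n v : nat) (u %/ _)%Z (v %/ _)%Z => a b p q; nia.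
Qed.

Lemma linear_lozenge_height n (k l : int) : k <= 0 -> 0 <= l -> l - k <= n.+1%:Z ->
  lozenge_height (linear_height n k l).
Proof.
by move=> k0 l0 lk x y; split; apply: divz_diff; lia.
Qed.

(** The sum to be bounded is the difference of h across one diagonal of the vertex minus that across
    the other: the former is at most 1 as l - k <= n + 1, the latter nonnegative as l + k <= 0. *)
Lemma linear_fv_height n (k l : int) : 0 <= l -> l + k <= 0 -> l - k <= n.+1%:Z ->
  fv_height (linear_height n k l).
Proof.
move=> l0 kl lk; split; first by apply: linear_lozenge_height; lia.
move=> x y; rewrite /linear_height.
have := divz_diff (n := n) (u := k * (x + 1) + l * y) (v := k * x + l * (y + 1)).
have := divz_diff (n := n) (u := k * (x + 1) + l * (y + 1)) (v := k * x + l * y).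
by lia.
Qed.

Lemma Z_lozenge_gt0 n (k l : int) : k <= 0 -> 0 <= l -> l - k <= n.+1%:Z ->
  0 < Z_lozenge r n.+1 k l.
Proof.
move=> k0 l0 lk; rewrite Z_lozengeE mulr_gt0 ?torus_weight_gt0 // ltr0n.
have T := linear_torus_height n k l; have L := linear_lozenge_height k0 l0 lk.
apply/card_gt0P; exists (config_of_height n (linear_height n k l)).
by rewrite inE (path_config_of_height T L) (height_change_of_height T L).
Qed.

Lemma Z_four_vertex_gt0 n (k l : int) : 0 <= l -> l + k <= 0 -> l - k <= n.+1%:Z ->
  0 < Z_four_vertex r n.+1 k l.
Proof.
move=> l0 kl lk; rewrite Z_four_vertexE mulr_gt0 ?torus_weight_gt0 // ltr0n.
have T := linear_torus_height n k l; have F := linear_fv_height l0 kl lk.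
apply/card_gt0P; exists (config_of_height n (linear_height n k l)).
by rewrite inE (four_vertex_config_of_height T F) (height_change_of_height T) //; case: F.
Qed.

End TorusWeight.

(** * Comparison of the surface tensions *)

Section Slopes.
Context {R : realType}.
Implicit Types p q : R * R.

Lemma scale_realE (a b : R) : a *: b = a * b.
Proof. by []. Qed.

Lemma newton_lozengeE p :
  newton_lozenge p <-> [/\ p.1 <= 0, 0 <= p.2 & p.2 - p.1 <= 1].
Proof.
case: p => s t /=; split=> [[u [v [w [u0 v0 w0 uvw [-> ->]]]]]|[s0 t0 st1]].
  by rewrite /GRing.scale /=; split; lra.
exists (1 + s - t), (- s), t; split; [lra|lra|lra|lra|].
by congr pair; rewrite /= !scale_realE; ring.
Qed.

Lemma newton_four_vertexE p :
  newton_four_vertex p <-> [/\ 0 <= p.2, p.1 + p.2 <= 0 & p.2 - p.1 <= 1].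
Proof.
case: p => s t /=; split=> [[u [v [w [u0 v0 w0 uvw [-> ->]]]]]|[t0 st0 st1]].
  by rewrite /GRing.scale /=; split; lra.
exists (1 + s - t), (- s - t), (2 * t); split; [lra|lra|lra|lra|].
by congr pair; rewrite /= !scale_realE; field.
Qed.

Lemma fst_continuous : continuous (@fst R R).
Proof. by move=> x; exact: cvg_fst. Qed.

Lemma snd_continuous : continuous (@snd R R).
Proof. by move=> x; exact: cvg_snd. Qed.

Lemma open_gt0 (f : R * R -> R) : continuous f -> open [set p | 0 < f p].
Proof.
move=> fc; have -> : [set p | 0 < f p] = f @^-1` [set x | 0 < x] by [].
apply: open_comp; last exact: open_gt.
by move=> x _; exact: fc.
Qed.

Lemma cvg_affine (a c : R) : (fun e : R => a + e * c) e @[e --> (0 : R)] --> a.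
Proof.
have : (fun e : R => a + e * c) e @[e --> (0 : R)] --> a + 0 * c.
  by apply: cvgD; [exact: cvg_cst|apply: cvgMr_tmp; exact: cvg_id].
by rewrite mul0r addr0.
Qed.

Lemma cvg_ray p (v : R * R) :
  (fun e : R => (p.1 + e * v.1, p.2 + e * v.2)) e @[e --> (0 : R)] --> p.
Proof.
case: p => a b; apply: (@cvg_pair _ _ _ (nbhs (0 : R)) (nbhs a) (nbhs b));
  exact: cvg_affine.
Qed.

Lemma interior_direction (A : set (R * R)) p (v : R * R) : A° p ->
  exists2 e, 0 < e & A (p.1 + e * v.1, p.2 + e * v.2).
Proof.
move=> Ap.
have /nbhs_ballP[e /= e0 eA] := cvg_ray v Ap.
exists (e / 2); first by rewrite divr_gt0.
by apply: eA; rewrite /ball /= sub0r normrN gtr0_norm ?divr_gt0 // ltr_pdivrMr //; lra.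
Qed.

Lemma newton_lozenge_interior p :
  newton_lozenge° p <-> [/\ p.1 < 0, 0 < p.2 & p.2 - p.1 < 1].
Proof.
split=> [Np|[s0 t0 st1]].
  have [e e0 /newton_lozengeE[/= + _ _]] := interior_direction (1, 0) Np.
  have [f f0 /newton_lozengeE[/= _ + _]] := interior_direction (0, -1) Np.
  have [g g0 /newton_lozengeE[/= _ _]] := interior_direction (0, 1) Np.
  by split; lra.
have O : open ([set p : R * R | 0 < - p.1] `&` [set p | 0 < p.2]
    `&` [set p | 0 < 1 - (p.2 - p.1)]).
  apply: openI; first apply: openI; apply: open_gt0 => x.
  - by apply: cvgN; exact: fst_continuous.
  - exact: snd_continuous.
  - apply: cvgB; first exact: cvg_cst.
    by apply: cvgB; [exact: snd_continuous|exact: fst_continuous].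
move: O; set D := (X in open X) => O.
have : D `<=` newton_lozenge° .
  rewrite -open_subsetE // => q [[/= q1 q2] q3].
  by apply/newton_lozengeE; split; lra.
by apply; rewrite /D /=; split; [split|]; lra.
Qed.

Lemma newton_four_vertex_interior p :
  newton_four_vertex° p <-> [/\ 0 < p.2, p.1 + p.2 < 0 & p.2 - p.1 < 1].
Proof.
split=> [Np|[t0 st0 st1]].
  have [e e0 /newton_four_vertexE[/= _ + _]] := interior_direction (1, 0) Np.
  have [f f0 /newton_four_vertexE[/= + _ _]] := interior_direction (0, -1) Np.
  have [g g0 /newton_four_vertexE[/= _ _]] := interior_direction (0, 1) Np.
  by split; lra.
have O : open ([set p : R * R | 0 < - (p.1 + p.2)] `&` [set p | 0 < p.2]
    `&` [set p | 0 < 1 - (p.2 - p.1)]).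
  apply: openI; first apply: openI; apply: open_gt0 => x.
  - by apply: cvgN; apply: cvgD; [exact: fst_continuous|exact: snd_continuous].
  - exact: snd_continuous.
  - apply: cvgB; first exact: cvg_cst.
    by apply: cvgB; [exact: snd_continuous|exact: fst_continuous].
move: O; set D := (X in open X) => O.
have : D `<=` newton_four_vertex° .
  rewrite -open_subsetE // => q [[/= q1 q2] q3].
  by apply/newton_four_vertexE; split; lra.
by apply; rewrite /D /=; split; [split|]; lra.
Qed.

Definition slope_map_inv q : R * R := ((q.1 + q.2) / (1 - q.2), q.2 / (1 - q.2)).

Lemma slope_mapK p : 0 < 1 + p.2 -> slope_map_inv (slope_map p) = p.
Proof.
case: p => s t /= t1; rewrite /slope_map /slope_map_inv /=.
have -> : 1 - t / (1 + t) = (1 + t)^-1 by field; lra.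
by congr pair; field; lra.
Qed.

Lemma slope_map_invK q : 0 < 1 - q.2 -> slope_map (slope_map_inv q) = q.
Proof.
case: q => s t /= t1; rewrite /slope_map /slope_map_inv /=.
have -> : 1 + t / (1 - t) = (1 - t)^-1 by field; lra.
by congr pair; field; lra.
Qed.

Lemma slope_map_newton p : newton_lozenge p -> newton_four_vertex (slope_map p).
Proof.
move=> /newton_lozengeE[s0 t0 st]; apply/newton_four_vertexE; rewrite /slope_map /=.
have t1 : 0 < 1 + p.2 by lra.
split; first by rewrite divr_ge0 // ltW.
  by rewrite -mulrDl -oppr_ge0 -mulNr divr_ge0 ?(ltW t1) //; lra.
by rewrite -mulrBl ler_pdivrMr //; lra.
Qed.

Lemma slope_map_inv_newton q : newton_four_vertex q -> newton_lozenge (slope_map_inv q).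
Proof.
move=> /newton_four_vertexE[t0 s0 st]; apply/newton_lozengeE; rewrite /slope_map_inv /=.
have t1 : 0 < 1 - q.2 by lra.
split; last by rewrite -mulrBl ler_pdivrMr //; lra.
  by rewrite -oppr_ge0 -mulNr divr_ge0 ?(ltW t1) //; lra.
by rewrite divr_ge0 // ltW.
Qed.

Lemma slope_map_interior p : newton_lozenge° p -> newton_four_vertex° (slope_map p).
Proof.
move=> /newton_lozenge_interior[s0 t0 st]; apply/newton_four_vertex_interior.
rewrite /slope_map /=; have t1 : 0 < 1 + p.2 by lra.
split; first by rewrite divr_gt0.
  by rewrite -mulrDl -oppr_gt0 -mulNr divr_gt0 //; lra.
by rewrite -mulrBl ltr_pdivrMr //; lra.
Qed.

Lemma slope_map_inv_interior q :
  newton_four_vertex° q -> newton_lozenge° (slope_map_inv q).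
Proof.
move=> /newton_four_vertex_interior[t0 s0 st]; apply/newton_lozenge_interior.
rewrite /slope_map_inv /=; have t1 : 0 < 1 - q.2 by lra.
split; last by rewrite -mulrBl ltr_pdivrMr //; lra.
  by rewrite -oppr_gt0 -mulNr divr_gt0 //; lra.
by rewrite divr_gt0.
Qed.

Lemma slope_map_image : slope_map @` newton_lozenge = newton_four_vertex :> set (R * R).
Proof.
apply/seteqP; split=> [_ [p Np <-]|q Nq]; first exact: slope_map_newton.
exists (slope_map_inv q); first exact: slope_map_inv_newton.
by rewrite slope_map_invK //; case/newton_four_vertexE: Nq; lra.
Qed.

Definition rational_slope (a b : int) (q : nat) : R * R :=
  (a%:~R / q%:R, b%:~R / q%:R).

Lemma rational_slope_dense p (U : set (R * R)) : newton_lozenge p -> nbhs p U ->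
  exists (a b : int) (q : nat), [/\ (0 < q)%N,
    newton_lozenge° (rational_slope a b q) & U (rational_slope a b q)].
Proof.
(* [c] points from p to the centroid (-1/3, 1/3) of the triangle: p may lie on the boundary, and a
   small step along [c] enters the interior. *)
move=> Np Up; set c : R * R := (- (1 / 3) - p.1, 1 / 3 - p.2).
have /nbhs_ballP[e /= e0 eU] := cvg_ray c (nbhs_interior Up).
pose f := Num.min (e / 2) 1.
have f0 : 0 < f by rewrite lt_min ltr01 divr_gt0.
have f1 : f <= 1 by rewrite ge_min lexx orbT.
have fe : f <= e / 2 by rewrite ge_min lexx.
pose x := (p.1 + f * c.1, p.2 + f * c.2).
have Ux : U° x.
  by apply: eU; rewrite /ball /= sub0r normrN gtr0_norm //; lra.
have Nx : newton_lozenge° x.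
  move/newton_lozengeE: Np => [s0 t0 st]; apply/newton_lozenge_interior.
  by rewrite /x /c /=; split; nra.
have /nbhs_ballP[d /= d0 dU] : nbhs x (U° `&` newton_lozenge°).
  by apply: filterI; apply: open_nbhs_nbhs; split=> //; exact: open_interior.
have [q1 /[!in_itv]/= /andP[q1l q1r]] := @rat_in_itvoo R x.1 (x.1 + d) (ltac:(lra)).
have [q2 /[!in_itv]/= /andP[q2l q2r]] := @rat_in_itvoo R x.2 (x.2 + d) (ltac:(lra)).
have D1 := denq_gt0 q1; have D2 := denq_gt0 q2.
exists (numq q1 * denq q2), (numq q2 * denq q1), (absz (denq q1 * denq q2)).
have qE : rational_slope (numq q1 * denq q2) (numq q2 * denq q1)
    (absz (denq q1 * denq q2)) = (ratr q1, ratr q2).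
  rewrite /rational_slope natr_absz gtr0_norm ?mulr_gt0 // /ratr !intrM.
  have {}D1 : (denq q1)%:~R != 0 :> R by rewrite intr_eq0 gt_eqF.
  have {}D2 : (denq q2)%:~R != 0 :> R by rewrite intr_eq0 gt_eqF.
  by congr pair; field; rewrite D1 D2.
have [Uq Nq] : (U° `&` newton_lozenge°) (ratr q1, ratr q2).
  by apply: dU; split; rewrite /= /ball /= ltr_norml; apply/andP; split; lra.
rewrite qE; split=> //; first by rewrite absz_gt0 mulf_neq0 // gt_eqF.
exact: interior_subset Uq.
Qed.

End Slopes.

Section Tension.
Context {R : realType}.
Implicit Types (Z : nat -> int -> int -> R) (N : set (R * R)).

Lemma cvg_floor_ratio (x : R) :
  (Num.floor (n%:R * x))%:~R / n%:R @[n --> \oo] --> x.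
Proof.
rewrite -cvg_shiftS /=.
apply: (@squeeze_cvgr _ _ _ _ (fun n => x - harmonic n) (fun=> x)).
- apply: nearW => n /=; have n0 : (0 : R) < n.+1%:R by rewrite ltr0n.
  have /andP[f1 f2] := floor_itv (n.+1%:R * x).
  rewrite intrD in f2.
  rewrite ler_pdivlMr // ler_pdivrMr // mulrBl mulVf ?gt_eqF //.
  by apply/andP; split; lra.
- rewrite -[X in _ --> X]subr0; apply: cvgB; first exact: cvg_cst.
  exact: cvg_harmonic.
exact: cvg_cst.
Qed.

(** The limit holds along any height changes of the right slope. The integer parts of n p are such,
    and on a side n = q w they are exactly a w and b w. *)
Lemma surface_tension_subseq Z N (sigma : R * R -> \bar R) (a b : int) (q : nat)
    (w : nat -> nat) :
  is_surface_tension Z N sigma -> (0 < q)%N -> N° (rational_slope a b q) ->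
  w @ \oo --> \oo ->
  - (ln (Z (q * w m)%N (a * (w m)%:Z) (b * (w m)%:Z)) / (q * w m)%N%:R ^+ 2)
    @[m --> \oo] --> fine (sigma (rational_slope a b q)).
Proof.
move=> [lim fin _ _] q0 Np w_oo; set p := rational_slope a b q in Np *.
have := lim p _ _ Np (@cvg_floor_ratio p.1) (@cvg_floor_ratio p.2).
rewrite -[sigma p]fineK; last by apply: fin; apply: interior_subset Np.
move=> /fine_cvg; move=> cv.
have u_oo : (fun m => (q * w m)%N) @ \oo --> \oo.
  exact: (cvg_comp w _ w_oo (@cvg_mulnl q q0)).
have := cvg_comp _ _ u_oo cv; apply: cvg_trans; apply: near_eq_cvg.
apply: nearW => m /=.
have E (c : int) : Num.floor ((q * w m)%N%:R * (c%:~R / q%:R) : R) = c * (w m)%:Z.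
  rewrite (_ : _ * _ = (c * (w m)%:Z)%:~R :> R) ?intrKfloor //.
  rewrite natrM intrM -[(w m)%:Z%:~R]pmulrn; field.
  by rewrite pnatr_eq0 -lt0n.
by rewrite /p /rational_slope /= !E.
Qed.

Lemma divf_div (x y z : R) : y != 0 -> z != 0 -> x / y / (z / y) = x / z.
Proof. by move=> y0 z0; field; rewrite y0 z0. Qed.

Lemma mulf_divdiv (x y z : R) : y != 0 -> z != 0 -> z * (x / (z / y)) = y * x.
Proof. by move=> y0 z0; field; rewrite y0 z0. Qed.

Lemma lnXn_div
 (z c : R) (n m : nat) : 0 < z -> 0 < c ->
  ln ((z / c ^+ n) ^+ m) = (ln z - ln c * n%:R) * m%:R.
Proof.
move=> z0 c0; have cn0 : 0 < c ^+ n by rewrite exprn_gt0.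
rewrite lnXn; last by rewrite divr_gt0.
by rewrite ln_div ?posrE // lnXn // !mulr_natr.
Qed.

(** L1 and L2 are logarithms of partition functions on sides x u and y x u^2, the latter being also
    the number of cells. The boundary loss L4 (x u) per cell becomes L4 / u after normalisation. *)
Lemma rescale_le (x y u L1 L2 L4 : R) : 0 < x -> 0 < y -> 0 < u ->
  (L1 - L4 * (x * u)) * (y * (x * (u * u))) <= L2 ->
  - (L2 / (y * (x * (u * u))) ^+ 2) * y
    <= - (L1 / (x * u) ^+ 2) * x + u^-1 * L4.
Proof.
move=> x0 y0 u0 le.
pose c := ((x * y) * (x * u ^+ 4))^-1.
have c0 : 0 <= c by rewrite invr_ge0 !mulr_ge0 ?exprn_ge0 ?ltW.
have -> : - (L2 / (y * (x * (u * u))) ^+ 2) * y = - (L2 * c).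
  by rewrite /c; field; rewrite !gt_eqF.
have -> : - (L1 / (x * u) ^+ 2) * x + u^-1 * L4 =
    - ((L1 - L4 * (x * u)) * (y * (x * (u * u))) * c).
  by rewrite /c; field; rewrite !gt_eqF.
by rewrite lerN2 ler_wpM2r.
Qed.

(* The factor [4 ^ n] is the number of boundary conditions on a torus of side
   [n]; it does not contribute to the limit. *)
Lemma surface_tension_compare Z1 Z2 N1 N2 (sigma1 sigma2 : R * R -> \bar R)
    (a1 b1 a2 b2 : int) (q1 q2 : nat) :
  is_surface_tension Z1 N1 sigma1 -> is_surface_tension Z2 N2 sigma2 ->
  (0 < q1)%N -> (0 < q2)%N ->
  N1° (rational_slope a1 b1 q1) -> N2° (rational_slope a2 b2 q2) ->
  (forall m, (0 < m)%N ->
    let n := (q1 * m)%N in let w := (q1 * (m * m))%N in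
    0 < Z1 n (a1 * m%:Z) (b1 * m%:Z) /\
    (Z1 n (a1 * m%:Z) (b1 * m%:Z) / 4 ^+ n) ^+ (q2 * w)
      <= Z2 (q2 * w)%N (a2 * w%:Z) (b2 * w%:Z)) ->
  q2%:R * fine (sigma2 (rational_slope a2 b2 q2))
    <= q1%:R * fine (sigma1 (rational_slope a1 b1 q1)).
Proof.
move=> st1 st2 q10 q20 Np1 Np2 Z12.
have S_oo : (fun m => m.+1) @ \oo --> \oo.
  by have := cvg_addnr 1; under eq_fun do rewrite addn1.
have w_oo : (fun m => (q1 * (m.+1 * m.+1))%N) @ \oo --> \oo.
  apply/cvgnyPge => A; near=> m.
  apply: (@leq_trans m); first by near: m; exact: nbhs_infty_ge.
  by rewrite mulnA; apply: leq_trans (leq_pmull _ _); rewrite ?muln_gt0 ?q10.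
have c1 := surface_tension_subseq st1 q10 Np1 S_oo.
have c2 := surface_tension_subseq st2 q20 Np2 w_oo.
have c1' := cvgD (cvgMr_tmp (b := q1%:R) c1) (cvgMr_tmp (b := ln 4) (@cvg_harmonic R)).
have c2' := cvgMr_tmp (b := q2%:R) c2.
rewrite mul0r addr0 in c1'.
rewrite mulrC [leRHS]mulrC. apply: (ler_cvg_to (c2' _) (c1' _ _ _)).
apply: nearW => m /=; have [Z1_gt0 Z2_ge] := Z12 m.+1 isT.
set w := (q1 * (m.+1 * m.+1))%N in Z2_ge *; set n := (q1 * m.+1)%N in Z1_gt0 Z2_ge *.
set z1 := Z1 _ _ _ in Z1_gt0 Z2_ge *; set z2 := Z2 _ _ _ in Z2_ge *.
have z14_gt0 : 0 < z1 / 4 ^+ n by rewrite divr_gt0 ?exprn_gt0.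
have : ln ((z1 / 4 ^+ n) ^+ (q2 * w)) <= ln z2.
  rewrite ler_ln ?posrE ?exprn_gt0 //; apply: lt_le_trans Z2_ge.
  by rewrite exprn_gt0.
rewrite fctE lnXn_div // -/n -/z1 /w /n !natrM.
by apply: rescale_le; rewrite ltr0n.
Unshelve. all: by end_near.
Qed.

Variables (r : R) (sigma sigma' : R * R -> \bar R).
Hypotheses (r1 : 1 < r) (sT : is_surface_tension (Z_lozenge r) newton_lozenge sigma)
  (sT' : is_surface_tension (Z_four_vertex r) newton_four_vertex sigma').

(** The comparisons in the two directions give opposite inequalities between (q + b) sigma' and q
    sigma, and (q + b) / q is 1 + t. *)
Lemma surface_tension_rational (a b : int) (q : nat) : (0 < q)%N ->
  let p : R * R := rational_slope a b q in newton_lozenge° p ->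
  fine (sigma' (slope_map p)) = fine (sigma p) / (1 + p.2).
Proof.
move=> q0 p Np; have qR : (0 : R) < q%:R by rewrite ltr0n.
have [a0 b0 ab] : [/\ a < 0, 0 < b & b - a < q%:Z].
  have [+ + +] := (newton_lozenge_interior p).1 Np; rewrite /p /=.
  rewrite -mulrBl !ltr_pdivrMr // ltr_pdivlMr // !mul0r mul1r.
  by rewrite -intrB ltrz0 ltr0z -[q%:R]/(q%:Z%:~R) ltr_int.
case: b b0 @p Np ab => // b b0 p Np ab.
have p2E : 1 + p.2 = (q + b)%N%:R / q%:R :> R.
  by rewrite /p /= natrD -[(Posz b)%:~R]/(b%:R); field; rewrite gt_eqF.
have qb0 : (0 < q + b)%N by rewrite addn_gt0 q0.
have qbR : (0 : R) < (q + b)%N%:R by rewrite ltr0n.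
have pE : slope_map p = rational_slope (a - b%:Z) b%:Z (q + b).
  by rewrite /slope_map p2E /p /rational_slope /= -mulrBl !divf_div ?gt_eqF // intrB.
have Np' := slope_map_interior Np; rewrite pE in Np' *.
have posM (d m : nat) : (0 < d)%N -> (0 < m)%N -> exists n, (d * m)%N = n.+1.
  by move=> d0 m0; exists (d * m).-1; rewrite prednK // muln_gt0 d0.
have le1 := @surface_tension_compare _ _ _ _ _ _ _ _ _ _ _ _ sT sT' q0 qb0 Np Np'.
have le2 := @surface_tension_compare _ _ _ _ _ _ _ _ _ _ _ _ sT' sT qb0 q0 Np' Np.
have {}le1 : (q + b)%N%:R * fine (sigma' (rational_slope (a - b%:Z) b%:Z (q + b)))
    <= q%:R * fine (sigma p).
  apply: le1 => m m0 n w; have [n' nE] := posM q m q0 m0.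
  have nZ : n'.+1%:Z = q%:Z * m%:Z by rewrite -nE PoszM.
  have mE : ((q + b) * w = n'.+1 * (n'.+1 + b * m))%N by rewrite -nE /w; ring.
  rewrite /n nE; split; first by apply: Z_lozenge_gt0 => //; rewrite ?nZ; nia.
  apply: le_trans (Z_four_vertex_ge r1 (a * m%:Z) mE) _.
  rewrite nZ le_eqVlt; apply/orP; left; apply/eqP.
  by congr Z_four_vertex; rewrite /w !PoszM; ring.
have {}le2 : q%:R * fine (sigma p)
    <= (q + b)%N%:R * fine (sigma' (rational_slope (a - b%:Z) b%:Z (q + b))).
  apply: le2 => m m0 n w; have [n' nE] := posM _ m qb0 m0.
  have nZ : n'.+1%:Z = (q%:Z + b%:Z) * m%:Z by rewrite -nE PoszM PoszD.
  have ln : (b * m < n'.+1)%N by rewrite -nE ltn_pmul2r // -{1}[b]add0n ltn_add2r.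
  have mE : (q * w = n'.+1 * (n'.+1 - b * m))%N.
    by rewrite -nE -mulnBl addnK /w; ring.
  rewrite /n nE; split; first by apply: Z_four_vertex_gt0 => //; rewrite ?nZ; nia.
  apply: le_trans (Z_lozenge_ge r1 ((a - b%:Z) * m%:Z) ln mE) _.
  rewrite nZ le_eqVlt; apply/orP; left; apply/eqP.
  by congr Z_lozenge; rewrite /w !PoszM PoszD; ring.
rewrite p2E; apply: (@mulfI _ (q + b)%N%:R); first by rewrite gt_eqF.
have -> : (q + b)%N%:R * fine (sigma' (rational_slope (a - b%:Z) b%:Z (q + b)))
    = q%:R * fine (sigma p) by apply/le_anti; rewrite le1 le2.
by rewrite mulf_divdiv ?gt_eqF.
Qed.

Lemma slope_map_cvg
 (p : R * R) : newton_lozenge p ->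
  slope_map x @[x --> within newton_lozenge (nbhs p)]
    --> within newton_four_vertex (nbhs (slope_map p)).
Proof.
move=> Np; have p2 : 1 + p.2 != 0 by case/newton_lozengeE: Np; lra.
have cv : slope_map x @[x --> p] --> slope_map p.
  have c1 := @fst_continuous R p; have c2 := @snd_continuous R p.
  have cV : (1 + x.2)^-1 @[x --> p] --> (1 + p.2)^-1.
    by apply: cvgV => //; apply: cvgD => //; exact: cvg_cst.
  apply: (@cvg_pair _ _ _ (nbhs p) (nbhs (slope_map p).1) (nbhs (slope_map p).2)).
    by apply: cvgM => //; apply: cvgB.
  by apply: cvgM.
move=> U WU; change (nbhs p (fun x => newton_lozenge x -> U (slope_map x))).
have W := cv _ WU; apply: (@filterS _ (nbhs p) _ _ _ _ W) => x Ux Nx.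
exact: (Ux (slope_map_newton Nx)).
Qed.

(** Both sides are continuous on the closed polygon. If they differed at p they would differ nearby,
    hence at some rational interior slope. *)
Lemma surface_tension_slope_map (p : R * R) : newton_lozenge p ->
  fine (sigma' (slope_map p)) = fine (sigma p) / (1 + p.2).
Proof.
move=> Np; have [_ fin /subspace_continuousP cs _] := sT.
have [_ fin' /subspace_continuousP cs' _] := sT'.
have Np' := slope_map_newton Np.
have p2 : 1 + p.2 != 0 by case/newton_lozengeE: Np; lra.
have c' : fine (sigma' (slope_map x)) @[x --> within newton_lozenge (nbhs p)]
    --> fine (sigma' (slope_map p)).
  apply: (@fine_cvg _ _ _ _ (sigma' \o slope_map)); rewrite fineK ?fin' //.
  exact: cvg_comp (slope_map_cvg Np) (cs' _ Np').
have c : fine (sigma x) / (1 + x.2) @[x --> within newton_lozenge (nbhs p)]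
    --> fine (sigma p) / (1 + p.2).
  apply: cvgM.
    by apply: (@fine_cvg _ _ _ _ sigma); rewrite fineK ?fin //; exact: cs.
  apply: cvgV => //; apply: cvgD; first exact: cvg_cst.
  by apply: cvg_trans (@snd_continuous R p); apply: cvg_app; exact: cvg_within.
apply/eqP; rewrite -subr_eq0; apply/negP => /negP d0.
have near0 := cvgr_neq0 _ (cvgB c' c) d0.
have [a [b [q [q0 Nx]]]] := rational_slope_dense Np (near0 _ _).
move=> /(_ (interior_subset Nx)).
by rewrite fctE (surface_tension_rational q0 Nx) subrr eqxx.
Qed.

End Tension.

(** * Functions of class C^k and the perspective function *)

Lemma near_eq_differentiable (R : numFieldType) (V W : normedModType R)
    (f g : V -> W) (p : V) :
  (\forall x \near p, f x = g x) -> differentiable f p -> differentiable g p.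
Proof.
move=> fg /diff_locallyP[dc /eqaddoP df].
have fgp : f p = g p := nbhs_singleton fg.
have sh : \forall h \near (0 : V), f (h + p) = g (h + p).
  have c0 : h + p @[h --> (0 : V)] --> p.
    by rewrite -[X in _ --> X]add0r; apply: cvgD; [exact: cvg_id|exact: cvg_cst].
  exact: (c0 _ fg).
have dg : g \o shift p = cst (g p) + 'd f p +o_ 0 id.
  apply/eqaddoP => e e0; have := df _ e0; apply: filterS2 sh => h fgh.
  by rewrite /= !fctE /= -fgp -fgh.
by apply/diff_locallyP; rewrite (diff_unique dc dg).
Qed.

Section PartialDerivatives.
Context {R : realType}.
Implicit Types (f g : R * R -> R) (p : R * R) (U V : set (R * R)).

Lemma fst_differentiable p : differentiable (@fst R R) p.
Proof.
pose l := (fst : {linear (R * R)%type -> R}).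
have c : continuous l by exact: fst_continuous.
exact: (linear_differentiable p c).
Qed.

Lemma snd_differentiable p : differentiable (@snd R R) p.
Proof.
pose l := (snd : {linear (R * R)%type -> R}).
have c : continuous l by exact: snd_continuous.
exact: (linear_differentiable p c).
Qed.

Lemma diff_partial f p (v : R * R) : differentiable f p ->
  'd f p v = v.1 * pd1 f p + v.2 * pd2 f p.
Proof.
move=> df; rewrite /pd1 /pd2 !deriveE //.
have -> : v = v.1 *: ((1, 0) : R * R) + v.2 *: ((0, 1) : R * R).
  by case: v => a b; congr pair; rewrite /= !scale_realE; ring.
by rewrite linearD !linearZ /= !scale_realE; ring.
Qed.

Section Chain.
Variables (f F1 F2 : R * R -> R) (p : R * R).
Hypotheses (d1 : differentiable F1 p) (d2 : differentiable F2 p)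
  (df : differentiable f (F1 p, F2 p)).

Lemma differentiable_chain : differentiable (fun x => f (F1 x, F2 x)) p.
Proof.
apply: (@differentiable_comp _ _ _ _ (fun x => (F1 x, F2 x)) f p) => //.
exact: differentiable_pair.
Qed.

Lemma derive_chain v : 'D_v (fun x => f (F1 x, F2 x)) p =
  pd1 f (F1 p, F2 p) * 'D_v F1 p + pd2 f (F1 p, F2 p) * 'D_v F2 p.
Proof.
rewrite deriveE; last exact: differentiable_chain.
have dF : differentiable (fun x => (F1 x, F2 x)) p by exact: differentiable_pair.
rewrite (@diff_comp _ _ _ _ (fun x => (F1 x, F2 x)) f p) //= diff_partial //.
rewrite (diff_pair d1 d2) (deriveE v d1) (deriveE v d2) /=.
by rewrite mulrC; congr (_ + _); rewrite mulrC.
Qed.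

Lemma pd1_chain : pd1 (fun x => f (F1 x, F2 x)) p =
  pd1 f (F1 p, F2 p) * pd1 F1 p + pd2 f (F1 p, F2 p) * pd1 F2 p.
Proof. exact: derive_chain. Qed.

Lemma pd2_chain : pd2 (fun x => f (F1 x, F2 x)) p =
  pd1 f (F1 p, F2 p) * pd2 F1 p + pd2 f (F1 p, F2 p) * pd2 F2 p.
Proof. exact: derive_chain. Qed.

End Chain.

Section Rules.
Variables (f g : R * R -> R) (p : R * R).
Hypotheses (df : differentiable f p) (dg : differentiable g p).

Lemma deriveD_fun v : 'D_v (fun x => f x + g x) p = 'D_v f p + 'D_v g p.
Proof. by rewrite -deriveD //; apply: diff_derivable. Qed.

Lemma deriveM_fun v : 'D_v (fun x => f x * g x) p = 'D_v f p * g p + f p * 'D_v g p.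
Proof.
have := @deriveM R _ f g p v (diff_derivable df) (diff_derivable dg).
by rewrite !scale_realE => ->; rewrite addrC mulrC.
Qed.

Lemma pd1D_fun : pd1 (fun x => f x + g x) p = pd1 f p + pd1 g p.
Proof. exact: deriveD_fun. Qed.

Lemma pd2D_fun : pd2 (fun x => f x + g x) p = pd2 f p + pd2 g p.
Proof. exact: deriveD_fun. Qed.

Lemma pd1M_fun : pd1 (fun x => f x * g x) p = pd1 f p * g p + f p * pd1 g p.
Proof. exact: deriveM_fun. Qed.

Lemma pd2M_fun : pd2 (fun x => f x * g x) p = pd2 f p * g p + f p * pd2 g p.
Proof. exact: deriveM_fun. Qed.

Lemma deriveV_fun v : f p != 0 ->
  'D_v (fun x => (f x)^-1) p = - 'D_v f p * ((f p)^-1 * (f p)^-1).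
Proof.
move=> f0; rewrite deriveV ?scale_realE //; last exact: diff_derivable.
by rewrite -exprVn; ring.
Qed.

Lemma differentiableD_fun : differentiable (fun x => f x + g x) p.
Proof. exact: differentiableD. Qed.

Lemma differentiableM_fun : differentiable (fun x => f x * g x) p.
Proof. exact: differentiableM. Qed.

End Rules.

Lemma pd_cst (c : R) p : pd1 (fun=> c) p = 0 /\ pd2 (fun=> c) p = 0.
Proof. by split; exact: derive_cst. Qed.

Lemma pd_fst p : pd1 (@fst R R) p = 1 /\ pd2 (@fst R R) p = 0.
Proof.
pose l := (fst : {linear (R * R)%type -> R}).
have c : continuous l by exact: fst_continuous.
have d := fst_differentiable p.
by rewrite /pd1 /pd2 !deriveE // (diff_lin p c).
Qed.

Lemma pd_snd p : pd1 (@snd R R) p = 0 /\ pd2 (@snd R R) p = 1.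
Proof.
pose l := (snd : {linear (R * R)%type -> R}).
have c : continuous l by exact: snd_continuous.
have d := snd_differentiable p.
by rewrite /pd1 /pd2 !deriveE // (diff_lin p c).
Qed.

Lemma near_open U p (P : R * R -> Prop) : open U -> U p ->
  (forall x, U x -> P x) -> \forall x \near p, P x.
Proof. by move=> oU Up UP; exact: (filterS UP (open_nbhs_nbhs (conj oU Up))). Qed.

Lemma pd1_eq_on U f g p : open U -> U p -> (forall x, U x -> f x = g x) ->
  pd1 f p = pd1 g p.
Proof. by move=> oU Up fg; apply: near_eq_derive; apply: near_open oU Up fg. Qed.

Lemma pd2_eq_on U f g p : open U -> U p -> (forall x, U x -> f x = g x) ->
  pd2 f p = pd2 g p.
Proof. by move=> oU Up fg; apply: near_eq_derive; apply: near_open oU Up fg. Qed.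

Lemma Ck_on_eq k U f g : open U -> (forall x, U x -> f x = g x) ->
  Ck_on k U f -> Ck_on k U g.
Proof.
move=> oU; elim: k f g => [|k IHk] f g fg /=.
  move=> cf p Up; have fgp : f p = g p by exact: fg.
  have near_fg : \forall x \near p, f x = g x by apply: near_open oU Up fg.
  suff : g x @[x --> p] --> g p by [].
  rewrite -fgp; apply: cvg_trans (cf p Up).
  by apply: near_eq_cvg; apply: filterS near_fg => x ->.
move=> [df c1 c2]; split=> [p Up||].
- by apply: near_eq_differentiable (df p Up); apply: near_open oU Up fg.
- by apply: IHk c1 => x Ux; apply: pd1_eq_on oU Ux fg.
- by apply: IHk c2 => x Ux; apply: pd2_eq_on oU Ux fg.
Qed.

Lemma Ck_onW k U f : Ck_on k.+1 U f -> Ck_on k U f.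
Proof.
elim: k f => [|k IHk] f /= [df c1 c2].
  by move=> p Up; apply: differentiable_continuous; exact: df.
split; [exact: df|exact: IHk c1|exact: IHk c2].
Qed.

Lemma Ck_on_cst k U (c : R) : Ck_on k U (fun=> c).
Proof.
elim: k c => [|k IHk] c /=; first by move=> p _; exact: cvg_cst.
split=> [p _||]; first exact: differentiable_cst.
  by rewrite (_ : pd1 _ = fun=> 0) //; apply/funext => p; have [] := pd_cst c p.
by rewrite (_ : pd2 _ = fun=> 0) //; apply/funext => p; have [] := pd_cst c p.
Qed.

Lemma Ck_on_fst k U : Ck_on k U (@fst R R).
Proof.
case: k => [p _|k]; first exact: fst_continuous.
split=> [p _||]; first exact: fst_differentiable.
  rewrite (_ : pd1 _ = fun=> 1); first exact: Ck_on_cst.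
  by apply/funext => p; have [] := pd_fst p.
rewrite (_ : pd2 _ = fun=> 0); first exact: Ck_on_cst.
by apply/funext => p; have [] := pd_fst p.
Qed.

Lemma Ck_on_snd k U : Ck_on k U (@snd R R).
Proof.
case: k => [p _|k]; first exact: snd_continuous.
split=> [p _||]; first exact: snd_differentiable.
  rewrite (_ : pd1 _ = fun=> 0); first exact: Ck_on_cst.
  by apply/funext => p; have [] := pd_snd p.
rewrite (_ : pd2 _ = fun=> 1); first exact: Ck_on_cst.
by apply/funext => p; have [] := pd_snd p.
Qed.

Section Closure.
Variable U : set (R * R).
Hypothesis oU : open U.

Lemma Ck_onD k f g : Ck_on k U f -> Ck_on k U g -> Ck_on k U (fun x => f x + g x).
Proof.
elim: k f g => [|k IHk] f g /=.
  by move=> cf cg p Up; apply: cvgD; [exact: cf|exact: cg].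
move=> [df f1 f2] [dg g1 g2]; split=> [p Up||].
- by apply: differentiableD_fun; [exact: df|exact: dg].
- apply: Ck_on_eq (IHk _ _ f1 g1) => // p Up.
  by rewrite /pd1 deriveD_fun; [|exact: df|exact: dg].
- apply: Ck_on_eq (IHk _ _ f2 g2) => // p Up.
  by rewrite /pd2 deriveD_fun; [|exact: df|exact: dg].
Qed.

Lemma Ck_onM k f g : Ck_on k U f -> Ck_on k U g -> Ck_on k U (fun x => f x * g x).
Proof.
elim: k f g => [|k IHk] f g.
  by move=> /= cf cg p Up; apply: cvgM; [exact: cf|exact: cg].
move=> Cf Cg; have fk := Ck_onW Cf; have gk := Ck_onW Cg.
move: Cf Cg => [df f1 f2] [dg g1 g2]; split=> [p Up||].
- by apply: differentiableM_fun; [exact: df|exact: dg].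
- apply: Ck_on_eq (Ck_onD (IHk _ _ f1 gk) (IHk _ _ fk g1)) => // p Up.
  by rewrite /pd1 deriveM_fun; [|exact: df|exact: dg].
- apply: Ck_on_eq (Ck_onD (IHk _ _ f2 gk) (IHk _ _ fk g2)) => // p Up.
  by rewrite /pd2 deriveM_fun; [|exact: df|exact: dg].
Qed.

Lemma Ck_onV k f : (forall p, U p -> f p != 0) ->
  Ck_on k U f -> Ck_on k U (fun x => (f x)^-1).
Proof.
move=> f0; elim: k => [|k IHk] Cf.
  by move=> p Up; apply: cvgV; [exact: f0|exact: Cf].
have Vk := IHk (Ck_onW Cf); have VV := Ck_onM Vk Vk.
have N1 := Ck_on_cst k U (-1).
move: Cf => [df f1 f2]; split=> [p Up||].
- by apply: differentiableV; [exact: df|exact: f0].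
- apply: Ck_on_eq (Ck_onM (Ck_onM N1 f1) VV) => // p Up.
  by rewrite /pd1 deriveV_fun ?f0 ?mulN1r //; exact: df.
- apply: Ck_on_eq (Ck_onM (Ck_onM N1 f2) VV) => // p Up.
  by rewrite /pd2 deriveV_fun ?f0 ?mulN1r //; exact: df.
Qed.

Lemma Ck_on_comp k V f (F1 F2 : R * R -> R) :
  (forall p, U p -> V (F1 p, F2 p)) -> Ck_on k U F1 -> Ck_on k U F2 ->
  Ck_on k V f -> Ck_on k U (fun x => f (F1 x, F2 x)).
Proof.
move=> UV; elim: k f => [|k IHk] f.
  move=> /= c1 c2 cf p Up; apply: (@cvg_comp _ _ _ (fun x => (F1 x, F2 x)) f _ (nbhs (F1 p, F2 p))).
    by apply: (@cvg_pair _ _ _ (nbhs p) (nbhs (F1 p)) (nbhs (F2 p))); [exact: c1|exact: c2].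
  by apply: cf; exact: UV.
move=> C1 C2; have k1 := Ck_onW C1; have k2 := Ck_onW C2.
move: C1 C2 => [d1 F11 F12] [d2 F21 F22] [df f1 f2]; split=> [p Up||].
- by apply: differentiable_chain; [exact: d1|exact: d2|apply: df; exact: UV].
- apply: Ck_on_eq (Ck_onD (Ck_onM (IHk _ k1 k2 f1) F11) (Ck_onM (IHk _ k1 k2 f2) F21)) => // p Up.
  by rewrite pd1_chain; [|exact: d1|exact: d2|apply: df; exact: UV].
- apply: Ck_on_eq (Ck_onD (Ck_onM (IHk _ k1 k2 f1) F12) (Ck_onM (IHk _ k1 k2 f2) F22)) => // p Up.
  by rewrite pd2_chain; [|exact: d1|exact: d2|apply: df; exact: UV].
Qed.

End Closure.

End PartialDerivatives.

(** * Derivatives and convexity of the perspective function *)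

Section Perspective.
Context {R : realType}.
Implicit Types p q : R * R.

Let phi1 q : R := (q.1 + q.2) * (1 - q.2)^-1.
Let phi2 q : R := q.2 * (1 - q.2)^-1.

Lemma differentiable_affine (a b c : R) p :
  differentiable (fun x : R * R => a * x.1 + (b * x.2 + c)) p.
Proof.
have d1 := @fst_differentiable R p; have d2 := @snd_differentiable R p.
apply: differentiableD_fun; first by apply: differentiableM_fun => //; exact: differentiable_cst.
apply: differentiableD_fun; last exact: differentiable_cst.
by apply: differentiableM_fun => //; exact: differentiable_cst.
Qed.

Lemma derive_affine (a b c : R) p :
  pd1 (fun x : R * R => a * x.1 + (b * x.2 + c)) p = a /\
  pd2 (fun x : R * R => a * x.1 + (b * x.2 + c)) p = b.
Proof.
have d1 := @fst_differentiable R p; have d2 := @snd_differentiable R p.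
have dc (k : R) : differentiable (fun _ : R * R => k) p by exact: differentiable_cst.
have [f1 f2] := pd_fst p; have [s1 s2] := pd_snd p.
have [ca1 ca2] := pd_cst a p; have [cb1 cb2] := pd_cst b p.
have [cc1 cc2] := pd_cst c p.
have m1 := differentiableM_fun (dc a) d1; have m2 := differentiableM_fun (dc b) d2.
have m3 := differentiableD_fun m2 (dc c).
rewrite /pd1 /pd2 in f1 f2 s1 s2 ca1 ca2 cb1 cb2 cc1 cc2 *.
by split; rewrite deriveD_fun // deriveM_fun // deriveD_fun // deriveM_fun //
  ?(f1, f2, s1, s2) ?(ca1, ca2) ?(cb1, cb2) ?(cc1, cc2); ring.
Qed.

Section Quotient.
Variables (u v : R * R -> R) (p : R * R).
Hypotheses (du : differentiable u p) (dv : differentiable v p) (v0 : v p != 0).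

Lemma differentiable_quotient : differentiable (fun x => u x * (v x)^-1) p.
Proof. by apply: differentiableM_fun => //; apply: differentiableV. Qed.

Lemma derive_quotient w : 'D_w (fun x => u x * (v x)^-1) p =
  'D_w u p * (v p)^-1 - u p * 'D_w v p * ((v p)^-1 * (v p)^-1).
Proof.
by rewrite deriveM_fun ?deriveV_fun //; [ring|apply: differentiableV].
Qed.

End Quotient.

Section SlopeMapInv.
Variable q : R * R.
Hypothesis q2 : 1 - q.2 != 0.

Let numE : (fun x : R * R => x.1 + x.2) = (fun x => 1 * x.1 + (1 * x.2 + 0)).
Proof. by apply/funext => x; ring. Qed.

Let sndE : (fun x : R * R => x.2) = (fun x => 0 * x.1 + (1 * x.2 + 0)).
Proof. by apply/funext => x; ring. Qed.

Let denE : (fun x : R * R => 1 - x.2) = (fun x => 0 * x.1 + (-1 * x.2 + 1)).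
Proof. by apply/funext => x; ring. Qed.

Let dnum : differentiable (fun x : R * R => x.1 + x.2) q.
Proof. by rewrite numE; exact: differentiable_affine. Qed.

Let dsnd : differentiable (fun x : R * R => x.2) q.
Proof. by rewrite sndE; exact: differentiable_affine. Qed.

Let dden : differentiable (fun x : R * R => 1 - x.2) q.
Proof. by rewrite denE; exact: differentiable_affine. Qed.

Lemma differentiable_phi : differentiable phi1 q /\ differentiable phi2 q.
Proof. by split; apply: differentiable_quotient. Qed.

Lemma pd_phi1 : pd1 phi1 q = (1 - q.2)^-1 /\
  pd2 phi1 q = (1 + q.1) * ((1 - q.2)^-1 * (1 - q.2)^-1).
Proof.
have [n1 n2] := derive_affine 1 1 0 q; have [e1 e2] := derive_affine 0 (-1) 1 q.
rewrite -numE /pd1 /pd2 in n1 n2; rewrite -denE /pd1 /pd2 in e1 e2.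
rewrite /pd1 /pd2 !(derive_quotient dnum dden q2) n1 n2 e1 e2.
by split; field.
Qed.

Lemma pd_phi2 : pd1 phi2 q = 0 /\ pd2 phi2 q = (1 - q.2)^-1 * (1 - q.2)^-1.
Proof.
have [n1 n2] := derive_affine 0 1 0 q; have [e1 e2] := derive_affine 0 (-1) 1 q.
rewrite -sndE /pd1 /pd2 in n1 n2; rewrite -denE /pd1 /pd2 in e1 e2.
rewrite /pd1 /pd2 !(derive_quotient dsnd dden q2) n1 n2 e1 e2.
by split; field.
Qed.

Lemma pd_den : differentiable (fun x : R * R => 1 - x.2) q /\
  (pd1 (fun x : R * R => 1 - x.2) q = 0 /\ pd2 (fun x : R * R => 1 - x.2) q = -1).
Proof.
split=> //; have := derive_affine 0 (-1) 1 q; by rewrite -denE.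
Qed.

End SlopeMapInv.

Lemma Ck_on_den k (U : set (R * R)) : open U -> Ck_on k U (fun x : R * R => 1 - x.2).
Proof.
move=> oU; have := Ck_onD oU (Ck_on_cst k U 1) (Ck_onM oU (Ck_on_cst k U (-1)) (Ck_on_snd k U)).
by apply: Ck_on_eq => // x _; rewrite mulN1r.
Qed.

Lemma Ck_on_phi k (U : set (R * R)) : open U -> (forall q, U q -> 1 - q.2 != 0) ->
  Ck_on k U phi1 /\ Ck_on k U phi2.
Proof.
move=> oU U0; have V := Ck_onV oU U0 (Ck_on_den k oU).
by split; apply: Ck_onM => //; [apply: Ck_onD => //; [exact: Ck_on_fst|exact: Ck_on_snd]
  |exact: Ck_on_snd].
Qed.

Lemma Ck_on_slope_map k (U : set (R * R)) (s t : R * R -> R) : open U ->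
  (forall q, U q -> 1 + t q != 0) -> Ck_on k U s -> Ck_on k U t ->
  Ck_on k U (fun z => (s z - t z) / (1 + t z)) /\ Ck_on k U (fun z => t z / (1 + t z)).
Proof.
move=> oU U0 cs ct; have C c := Ck_on_cst k U c.
have V := Ck_onV oU U0 (Ck_onD oU (C 1) ct).
split; apply: Ck_onM => //.
have := Ck_onD oU cs (Ck_onM oU (C (-1)) ct).
by apply: Ck_on_eq => // x _; rewrite mulN1r.
Qed.

Section Derivatives.
Variables (f f' : R * R -> R).
Hypothesis fS : smooth_on newton_lozenge° f.
Hypothesis f'E : forall q, newton_four_vertex° q ->
  f' q = (1 - q.2) * f (slope_map_inv q).

Let V : set (R * R) := newton_four_vertex°.
Let oV : open V. Proof. exact: open_interior. Qed.

Let V2 q : V q -> 0 < 1 - q.2.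
Proof. by case/newton_four_vertex_interior; lra. Qed.

Let V0 q : V q -> 1 - q.2 != 0.
Proof. by move=> /V2; rewrite lt0r => /andP[]. Qed.

Let phiU q : V q -> newton_lozenge° (phi1 q, phi2 q).
Proof. exact: slope_map_inv_interior. Qed.

Lemma smooth_perspective : smooth_on V f'.
Proof.
move=> k; have [c1 c2] := Ck_on_phi k oV V0.
apply: Ck_on_eq (Ck_onM oV (Ck_on_den k oV) (Ck_on_comp oV phiU c1 c2 (fS k))) => //.
by move=> q /f'E ->.
Qed.

Let df p : newton_lozenge° p -> differentiable f p.
Proof. by have [d _ _] := fS 1; exact: d. Qed.

Let df1 p : newton_lozenge° p -> differentiable (pd1 f) p.
Proof. by have [_ [d _ _] _] := fS 2; exact: d. Qed.

Let df2 p : newton_lozenge° p -> differentiable (pd2 f) p.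
Proof. by have [_ _ [d _ _]] := fS 2; exact: d. Qed.

(** The derivative of f' in t', read at the slope p of the lozenge model: - f comes from the factor
    1 - t', and the chain rule yields the coefficients 1 + s = (1 + s') / (1 - t') and 1 + t = 1 /
    (1 - t'). *)
Let G p : R := - f p + (1 + p.1) * pd1 f p + (1 + p.2) * pd2 f p.

Lemma pd1_perspective q : V q -> pd1 f' q = pd1 f (slope_map_inv q).
Proof.
move=> Vq; have q0 := V0 Vq; have [dd [dd1 dd2]] := pd_den q.
have [dp1 dp2] := differentiable_phi q0.
have [p11 p12] := pd_phi1 q0; have [p21 p22] := pd_phi2 q0.
have dc := differentiable_chain dp1 dp2 (df (phiU Vq)).
rewrite (pd1_eq_on oV Vq f'E) (pd1M_fun dd dc).
rewrite dd1 (pd1_chain dp1 dp2 (df (phiU Vq))) p11 p21.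
by rewrite mul0r add0r mulr0 addr0 mulrCA divff // mulr1.
Qed.

Lemma pd2_perspective q : V q -> pd2 f' q = G (slope_map_inv q).
Proof.
move=> Vq; have q0 := V0 Vq; have [dd [dd1 dd2]] := pd_den q.
have [dp1 dp2] := differentiable_phi q0.
have [p11 p12] := pd_phi1 q0; have [p21 p22] := pd_phi2 q0.
have dc := differentiable_chain dp1 dp2 (df (phiU Vq)).
rewrite (pd2_eq_on oV Vq f'E) (pd2M_fun dd dc).
rewrite dd2 (pd2_chain dp1 dp2 (df (phiU Vq))) p12 p22 /G /slope_map_inv /=.
rewrite -/(phi1 q) -/(phi2 q); move: (f _) (pd1 f _) (pd2 f _) => a b c.
by rewrite /phi1 /phi2; field.
Qed.

Let pdG p : newton_lozenge° p -> [/\ differentiable G p,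
  pd1 G p = (1 + p.1) * pd1 (pd1 f) p + (1 + p.2) * pd1 (pd2 f) p
  & pd2 G p = (1 + p.1) * pd2 (pd1 f) p + (1 + p.2) * pd2 (pd2 f) p].
Proof.
move=> Up; have d0 := df Up; have d1 := df1 Up; have d2 := df2 Up.
have a1 := derive_affine 1 0 1 p; have a2 := derive_affine 0 1 1 p.
have da1 := differentiable_affine 1 0 1 p; have da2 := differentiable_affine 0 1 1 p.
have dc : differentiable (fun _ : R * R => -1 : R) p by exact: differentiable_cst.
have [c1 c2] := pd_cst (-1) p.
have GE : G = fun p => (-1 * f p + (1 * p.1 + (0 * p.2 + 1)) * pd1 f p)
    + (0 * p.1 + (1 * p.2 + 1)) * pd2 f p.
  by apply/funext => x; rewrite /G; ring.
have m0 := differentiableM_fun dc d0; have m1 := differentiableM_fun da1 d1.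
have m2 := differentiableM_fun da2 d2; have m3 := differentiableD_fun m0 m1.
rewrite GE; split; first exact: differentiableD_fun.
  rewrite (pd1D_fun m3 m2) (pd1D_fun m0 m1) (pd1M_fun dc d0) (pd1M_fun da1 d1).
  rewrite (pd1M_fun da2 d2) c1 a1.1 a2.1 /=.
  move: (pd1 (pd1 f) p) (pd1 (pd2 f) p) (pd1 f p) (pd2 f p) (f p) => *; ring.
rewrite (pd2D_fun m3 m2) (pd2D_fun m0 m1) (pd2M_fun dc d0) (pd2M_fun da1 d1).
rewrite (pd2M_fun da2 d2) c2 a1.2 a2.2 /=.
move: (pd2 (pd1 f) p) (pd2 (pd2 f) p) (pd1 f p) (pd2 f p) (f p) => *; ring.
Qed.

(** The gradient of f' being (f_s, G) at the inverse slope, one more chain rule suffices. The mixed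
    derivatives [B] and [B'] are kept apart; their equality is deduced later from the Cauchy-Riemann
    relations. *)
Lemma hessian_perspective q : V q ->
  let p := slope_map_inv q in let c := 1 + p.2 in let e := 1 + p.1 in
  let A := pd1 (pd1 f) p in let B := pd2 (pd1 f) p in
  let B' := pd1 (pd2 f) p in let D := pd2 (pd2 f) p in
  [/\ pd1 (pd1 f') q = A * c, pd2 (pd1 f') q = c * (A * e + B * c),
      pd1 (pd2 f') q = c * (e * A + c * B')
    & pd2 (pd2 f') q = c * (e * (e * A + c * B') + c * (e * B + c * D))].
Proof.
move=> Vq p c e A B B' D; have q0 := V0 Vq.
have [dp1 dp2] := differentiable_phi q0.
have [p11 p12] := pd_phi1 q0; have [p21 p22] := pd_phi2 q0.
have Up := phiU Vq; have [dG G1 G2] := pdG Up.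
have cE : c = (1 - q.2)^-1 by rewrite /c /p /=; field.
have eE : e = (1 + q.1) * (1 - q.2)^-1 by rewrite /e /p /=; field.
have {}p12 : pd2 phi1 q = e * c by rewrite p12 eE cE; ring.
have {}p22 : pd2 phi2 q = c * c by rewrite p22 cE.
rewrite -cE in p11.
have -> : pd1 (pd1 f') q = pd1 (fun q => pd1 f (phi1 q, phi2 q)) q.
  exact: pd1_eq_on oV Vq pd1_perspective.
have -> : pd2 (pd1 f') q = pd2 (fun q => pd1 f (phi1 q, phi2 q)) q.
  exact: pd2_eq_on oV Vq pd1_perspective.
have -> : pd1 (pd2 f') q = pd1 (fun q => G (phi1 q, phi2 q)) q.
  exact: pd1_eq_on oV Vq pd2_perspective.
have -> : pd2 (pd2 f') q = pd2 (fun q => G (phi1 q, phi2 q)) q.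
  exact: pd2_eq_on oV Vq pd2_perspective.
rewrite (pd1_chain dp1 dp2 (df1 Up)) (pd2_chain dp1 dp2 (df1 Up)).
rewrite (pd1_chain dp1 dp2 dG) (pd2_chain dp1 dp2 dG) G1 G2.
rewrite p11 p12 p21 p22 -/(slope_map_inv q) -/p -/A -/B -/B' -/D -/c -/e.
by move: (A) (B) (B') (D) (c) (e) => *; split; ring.
Qed.

Lemma strictly_convex_perspective :
  strictly_convex_on newton_lozenge° f -> strictly_convex_on V f'.
Proof.
move=> fC q1 q2 u V1 V2' q12 u0 u1.
have w1 := V2 V1; have w2 := V2 V2'.
have [q qdef] : exists q, q = u *: q1 + (1 - u) *: q2 by eexists.
have qE : q = (u * q1.1 + (1 - u) * q2.1, u * q1.2 + (1 - u) * q2.2).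
  by rewrite qdef; case: (q1) (q2) => a b [c d].
have Vq : V q.
  rewrite qE; apply/newton_four_vertex_interior => /=.
  move/newton_four_vertex_interior: V1 => [a1 b1 c1].
  move/newton_four_vertex_interior: V2' => [a2 b2 c2].
  by split; nra.
have wE : 1 - q.2 = u * (1 - q1.2) + (1 - u) * (1 - q2.2) by rewrite qE /=; ring.
(* A projective map sends segments to segments but changes ratios: the weight u becomes x, and the
   factor 1 - t' of f' turns it back into u. *)
have w0 := V2 Vq; pose x := u * (1 - q1.2) / (1 - q.2).
have x0 : 0 < x by rewrite divr_gt0 // mulr_gt0.
have x1E : 1 - x = (1 - u) * (1 - q2.2) / (1 - q.2).
  by apply: (@mulIf _ (1 - q.2)); rewrite ?V0 // mulrBl !mulfVK ?V0 // mul1r {1}wE; ring.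
have x1 : x < 1 by rewrite -subr_gt0 x1E divr_gt0 // mulr_gt0 // subr_gt0.
have mixE : slope_map_inv q = x *: slope_map_inv q1 + (1 - x) *: slope_map_inv q2.
  have q10 := V0 V1; have q20 := V0 V2'; have q00 := V0 Vq.
  rewrite x1E /x /slope_map_inv; apply/pair_equal_spec; split=> /=; rewrite !scale_realE.
    transitivity ((u * (q1.1 + q1.2) + (1 - u) * (q2.1 + q2.2)) / (1 - q.2)).
      by rewrite [in X in X / _]qE /=; congr (_ / _); ring.
    by field; rewrite q00 q10 q20.
  transitivity ((u * q1.2 + (1 - u) * q2.2) / (1 - q.2)).
    by rewrite [in X in X / _]qE.
  by field; rewrite q00 q10 q20.
have p12 : slope_map_inv q1 != slope_map_inv q2.
  apply: contraNneq q12 => e; apply/eqP.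
  by rewrite -(slope_map_invK w1) -(slope_map_invK w2) e.
have := fC _ _ x (slope_map_inv_interior V1) (slope_map_inv_interior V2') p12 x0 x1.
have e1 : (1 - q.2) * x = u * (1 - q1.2) by rewrite mulrC divfK ?V0.
have e2 : (1 - q.2) * (1 - x) = (1 - u) * (1 - q2.2) by rewrite x1E mulrC divfK ?V0.
rewrite -mixE -(ltr_pM2l w0) -qdef !f'E // mulrDr.
by rewrite (mulrA _ x) e1 (mulrA _ (1 - x)) e2 -!mulrA.
Qed.

End Derivatives.

End Perspective.

(** * Isothermal coordinates *)

Lemma det_mx2 (R : comNzRingType) (M : 'M[R]_2) :
  \det M = M ord0 ord0 * M ord_max ord_max - M ord0 ord_max * M ord_max ord0.
Proof.
rewrite (expand_det_row _ ord0) !big_ord_recl big_ord0 addr0 /cofactor.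
rewrite !det_mx11 !mxE /= expr0 expr1 mul1r mulN1r mulrN.
have -> : lift (ord0 : 'I_2) ord0 = ord_max by apply/val_inj.
have -> : lift (ord_max : 'I_2) ord0 = ord0 by apply/val_inj.
by [].
Qed.

Lemma det_hessian (R : realType) (f : R * R -> R) (p : R * R) :
  \det (hessian f p) =
  pd1 (pd1 f) p * pd2 (pd2 f) p - pd2 (pd1 f) p * pd1 (pd2 f) p.
Proof. by rewrite det_mx2 !mxE. Qed.

Lemma wirtinger_eqD (R : realType) (f g : R * R -> R) (z : R * R) (k : R) :
  wirtinger f z + 'i%C * k%:C%C * wirtinger g z = 0 ->
  pd1 f z = - k * pd2 g z /\ pd2 f z = k * pd1 g z.
Proof.
rewrite /wirtinger [_ * _ * (_ * _)]mulrCA -mulrDr => /eqP.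
rewrite mulf_eq0 invr_eq0 pnatr_eq0 /= eq_complex /= => /andP[/eqP re /eqP im].
by split; lra.
Qed.

(* The Hessian is determined by the Cauchy-Riemann relations, since the
   Jacobian of an isothermal coordinate does not vanish. *)
Lemma cauchy_riemann_hessian (R : realFieldType) (k l A B B' D sx sy tx ty : R) :
  0 < l ->
  A * sx * sx + B * (sx * tx + tx * sx) + D * tx * tx = l ->
  A * sy * sy + B * (sy * ty + ty * sy) + D * ty * ty = l ->
  A * sx * sy + B * (sx * ty + tx * sy) + D * tx * ty = 0 ->
  A * sx + B * tx = - k * ty -> A * sy + B * ty = k * tx ->
  B' * sx + D * tx = k * sy -> B' * sy + D * ty = - k * sx ->
  B' = B /\ A * D - B * B' = k ^+ 2.
Proof.
move=> l0 m11 m22 m12 c1 c2 c3 c4; pose J := sx * ty - sy * tx.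
have J0 : J != 0.
  (* The Gram determinant of the two tangent vectors is A D - B^2 times J^2; if J vanished, so would
     l^2. *)
  have e : (A * sx * sx + B * (sx * tx + tx * sx) + D * tx * tx)
    * (A * sy * sy + B * (sy * ty + ty * sy) + D * ty * ty)
    - (A * sx * sy + B * (sx * ty + tx * sy) + D * tx * ty) ^+ 2
    = (A * D - B * B) * J ^+ 2 by rewrite /J; ring.
  apply/eqP => Je; rewrite m11 m22 m12 Je !expr0n /= mulr0 subr0 in e.
  by have := mulr_gt0 l0 l0; rewrite e ltxx.
have BJ : B * J = k * (sx * tx + sy * ty).
  have -> : B * J = sx * (A * sy + B * ty) - sy * (A * sx + B * tx) by rewrite /J; ring.
  by rewrite c1 c2; ring.
have B'J : B' * J = k * (sx * tx + sy * ty).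
  have -> : B' * J = ty * (B' * sx + D * tx) - tx * (B' * sy + D * ty) by rewrite /J; ring.
  by rewrite c3 c4; ring.
split; first by apply: (mulIf J0); rewrite BJ.
apply: (mulIf J0).
have -> : (A * D - B * B') * J = (A * sx + B * tx) * (B' * sy + D * ty)
  - (A * sy + B * ty) * (B' * sx + D * tx) by rewrite /J; ring.
by rewrite c1 c2 c3 c4 /J; ring.
Qed.

(** [d1] and [d2] are the components of the differential of [slope_map]. The left side is c times
    the form with coefficients A, B, D in the variables d1 + e d2 and c d2, and these are the
    original vector divided by c. *)
Lemma perspective_metric (R : realFieldType) (A B D s t u1 u2 v1 v2 : R) :
  0 < 1 + t ->
  let c := 1 + t in let e := 1 + s in
  let d1 x y := (x - y) * c^-1 - (s - t) * y * (c^-1 * c^-1) in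
  let d2 y := y * c^-1 - t * y * (c^-1 * c^-1) in
  A * c * d1 u1 u2 * d1 v1 v2
  + c * (A * e + B * c) * (d1 u1 u2 * d2 v2 + d2 u2 * d1 v1 v2)
  + c * (e * (e * A + c * B) + c * (e * B + c * D)) * d2 u2 * d2 v2
  = (A * u1 * v1 + B * (u1 * v2 + u2 * v1) + D * u2 * v2) / c.
Proof.
move=> t1 c e d1 d2; have c0 : c != 0 by rewrite gt_eqF.
have d1E x y : d1 x y = (c * x - e * y) / (c * c).
  by rewrite /d1 /e /c; field; rewrite gt_eqF.
have d2E y : d2 y = y / (c * c) by rewrite /d2 /c; field; rewrite gt_eqF.
by rewrite !d1E !d2E; move: (c) (e) c0 => c' e' c'0; field.
Qed.

Theorem mainTheorem2 (R : realType) (r : R) (sigma sigma' : R * R -> \bar R)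
    (s t : R * R -> R) :
  let H : set (R * R) := upper_half_plane in
  let N : set (R * R) := newton_lozenge in
  let N' : set (R * R) := newton_four_vertex in
  let st (z : R * R) : R * R := (s z, t z) in
  let st' (z : R * R) : R * R := slope_map (st z) in
  let X (z : R * R) : R := pd1 (fine \o sigma) (st z) in
  let Y (z : R * R) : R := pd2 (fine \o sigma) (st z) in
  1 < r ->
  is_surface_tension (Z_lozenge r) N sigma ->
  is_surface_tension (Z_four_vertex r) N' sigma' ->
  intrinsic_coordinate N (fine \o sigma) H st ->
  harmonic_on H s -> harmonic_on H t -> harmonic_on H X -> harmonic_on H Y ->
  (forall z, H z -> wirtinger X z + 'i%C * pi%:C%C * wirtinger t z = 0) ->
  (forall z, H z -> wirtinger Y z - 'i%C * pi%:C%C * wirtinger s z = 0) ->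
  [/\ (* (i) *)
      slope_map @` N = N'
      /\ (forall p, N p ->
            let q := slope_map p in
            let p' := ((q.1 + q.2) / (1 - q.2), q.2 / (1 - q.2)) in
            sigma' q = ((1 - q.2)%R%:E * sigma p')%E
            /\ sigma' q = ((1 + p.2)^-1%R%:E * sigma p)%E),
      (* (ii) *)
      intrinsic_coordinate N' (fine \o sigma') H st'
      /\ (forall z, H z ->
            kappa (fine \o sigma') (st' z) = pi * (1 + t z) ^+ 2)
    & (* (iii) *)
      [/\ forall z, H z ->
            Num.sqrt (kappa (fine \o sigma') (st' z))
            = Num.sqrt pi * (1 + t z),
          harmonic_on H (fun z => Num.sqrt (kappa (fine \o sigma') (st' z)))
        & trivial_potential N' (fine \o sigma')]].
Proof.
move=> H N N' st st' X Y r1 sT sT' [fS fC oH [G [[sS tS] [GS1 GS2] stU GU [stK GK]]] conf].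
move=> [C2s _] [C2t lapt] _ _ crX crY.
set f := fine \o sigma in fS fC conf X Y crX crY *; set f' := fine \o sigma'.
have oV : open (newton_four_vertex° : set (R * R)) by exact: open_interior.
have V0 (q : R * R) : newton_four_vertex° q -> 0 < 1 - q.2.
  by case/newton_four_vertex_interior; lra.
have f'E (q : R * R) : newton_four_vertex° q -> f' q = (1 - q.2) * f (slope_map_inv q).
  move=> Vq; have q0 := V0 q Vq.
  have Np := slope_map_inv_newton (interior_subset Vq).
  rewrite -{1}(slope_map_invK q0) /f' /= (surface_tension_slope_map r1 sT sT' Np).
  have -> : 1 + (slope_map_inv q).2 = (1 - q.2)^-1.
    by rewrite /slope_map_inv /=; field; rewrite gt_eqF.
  by rewrite invrK mulrC.
have stN z : H z -> newton_lozenge° (st z) := stU z.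
have c0 z : H z -> 0 < 1 + t z.
  by move=> /stN/newton_lozenge_interior[/=]; lra.
have cn0 z : H z -> 1 + t z != 0 by move=> /c0; rewrite lt0r => /andP[].
have stV z : H z -> newton_four_vertex° (st' z) by move=> /stN; exact: slope_map_interior.
have st'K z : H z -> slope_map_inv (st' z) = st z.
  by move=> Hz; exact: (@slope_mapK R (st z) (c0 z Hz)).
have ds z : H z -> differentiable s z by have [d _ _] := C2s; exact: d.
have dt z : H z -> differentiable t z by have [d _ _] := C2t; exact: d.
have df1 z : H z -> differentiable (pd1 f) (st z).
  by move=> /stN; have [_ [d _ _] _] := fS 2%N; exact: d.
have df2 z : H z -> differentiable (pd2 f) (st z).
  by move=> /stN; have [_ _ [d _ _]] := fS 2%N; exact: d.
have hessE z : H z -> exists2 l, 0 < l & [/\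
    hessian_metric f (st z) (pd1 s z, pd1 t z) (pd1 s z, pd1 t z) = l,
    hessian_metric f (st z) (pd2 s z, pd2 t z) (pd2 s z, pd2 t z) = l,
    hessian_metric f (st z) (pd1 s z, pd1 t z) (pd2 s z, pd2 t z) = 0,
    pd1 (pd2 f) (st z) = pd2 (pd1 f) (st z)
  & pd1 (pd1 f) (st z) * pd2 (pd2 f) (st z)
    - pd2 (pd1 f) (st z) * pd1 (pd2 f) (st z) = pi ^+ 2].
  move=> Hz; have [l [l0 m11 m22 m12]] := conf z Hz; exists l; first exact: l0.
  have [x1 x2] := wirtinger_eqD (crX z Hz).
  (* The second relation has the form of the first, with - pi in place of pi. *)
  have crY' : wirtinger Y z + 'i%C * (- pi)%:C%C * wirtinger s z = 0.
    by rewrite rmorphN mulrN mulNr; exact: crY.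
  have [y1 y2] := wirtinger_eqD crY'.
  rewrite /X (pd1_chain (ds z Hz) (dt z Hz) (df1 z Hz)) in x1.
  rewrite /X (pd2_chain (ds z Hz) (dt z Hz) (df1 z Hz)) in x2.
  rewrite /Y (pd1_chain (ds z Hz) (dt z Hz) (df2 z Hz)) opprK in y1.
  rewrite /Y (pd2_chain (ds z Hz) (dt z Hz) (df2 z Hz)) in y2.
  have [BE detE] := cauchy_riemann_hessian l0 m11 m22 m12 x1 x2 y1 y2.
  split; [exact: m11|exact: m22|exact: m12|exact: BE|exact: detE].
have hess' z : H z -> let c := 1 + t z in let e := 1 + s z in
    let A := pd1 (pd1 f) (st z) in let B := pd2 (pd1 f) (st z) in
    let B' := pd1 (pd2 f) (st z) in let D := pd2 (pd2 f) (st z) in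
    [/\ pd1 (pd1 f') (st' z) = A * c, pd2 (pd1 f') (st' z) = c * (A * e + B * c),
        pd1 (pd2 f') (st' z) = c * (e * A + c * B')
      & pd2 (pd2 f') (st' z) = c * (e * (e * A + c * B') + c * (e * B + c * D))].
  by move=> Hz; have := hessian_perspective fS f'E (stV z Hz); rewrite st'K.
have kappaE z : H z -> kappa f' (st' z) = pi * (1 + t z) ^+ 2.
  move=> Hz; have [l _ [_ _ _ _ detE]] := hessE z Hz.
  rewrite /kappa det_hessian; have [-> -> -> ->] := hess' z Hz.
  set A := pd1 (pd1 f) _ in detE *; set B := pd2 (pd1 f) _ in detE *.
  set B' := pd1 (pd2 f) _ in detE *; set D := pd2 (pd2 f) _ in detE *.
  (* All terms in 1 + s cancel from the determinant, leaving the fourth power of 1 + t as a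
     factor. *)
  transitivity (Num.sqrt ((1 + t z) ^+ 4 * (A * D - B * B'))).
    by congr Num.sqrt; move: (A) (B) (B') (D) (s z) (t z) => *; ring.
  rewrite detE -[4%N]/(2 * 2)%N exprM -exprMn sqrtr_sqr ger0_norm 1?mulrC //.
  by rewrite mulr_ge0 ?pi_ge0 // exprn_ge0 // ltW // c0.
have coord : intrinsic_coordinate N' f' H st'.
  split=> //; first exact: smooth_perspective fS f'E.
  - exact: strictly_convex_perspective f'E fC.
  - exists (G \o slope_map_inv); split.
    + by split=> k; have [c1 c2] := Ck_on_slope_map oH cn0 (sS k) (tS k).
    + have V0' q : newton_four_vertex° q -> 1 - q.2 != 0 :> R.
        by move=> /V0; rewrite lt0r => /andP[].
      split=> k.
        have [c1 c2] := Ck_on_phi k oV V0'.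
        exact: (@Ck_on_comp R _ oV k _ (fst \o G) _ _ (@slope_map_inv_interior R) c1 c2 (GS1 k)).
      have [c1 c2] := Ck_on_phi k oV V0'.
      exact: (@Ck_on_comp R _ oV k _ (snd \o G) _ _ (@slope_map_inv_interior R) c1 c2 (GS2 k)).
    + by move=> z; exact: stV.
    + by move=> q Vq; apply: GU; exact: slope_map_inv_interior.
    split=> [z /set_mem Hz|q /set_mem Vq] /=; first by rewrite st'K // stK ?mem_set.
    rewrite /st' (_ : st (G (slope_map_inv q)) = slope_map_inv q).
      by rewrite slope_map_invK // V0.
    by apply: GK; apply: mem_set; exact: slope_map_inv_interior.
  move=> z Hz Fx Fy; have [l l0 [m11 m22 m12 BE _]] := hessE z Hz.
  exists (l / (1 + t z)).
  have [h11 h12 _ h22] := hess' z Hz; rewrite BE in h22.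
  have d1 (a : R) : differentiable (fun _ : R * R => a) z by exact: differentiable_cst.
  have dc := differentiableD_fun (d1 1) (dt z Hz).
  have dm := differentiableM_fun (d1 (-1)) (dt z Hz).
  have dn := differentiableD_fun (ds z Hz) dm.
  have numE : (fun x => s x + -1 * t x) = (fun x => s x - t x).
    by apply/funext => x; rewrite mulN1r.
  have dcE w : 'D_w (fun x => 1 + t x) z = 'D_w t z.
    by rewrite (deriveD_fun (d1 1) (dt z Hz)) derive_cst add0r.
  have dnE w : 'D_w (fun x => s x - t x) z = 'D_w s z - 'D_w t z.
    rewrite -numE (deriveD_fun (ds z Hz) dm) (deriveM_fun (d1 (-1)) (dt z Hz)).
    by rewrite derive_cst mul0r add0r mulN1r.
  rewrite numE in dn.
  have F1 w : 'D_w (fst \o st') z = ('D_w s z - 'D_w t z) * (1 + t z)^-1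
      - (s z - t z) * 'D_w t z * ((1 + t z)^-1 * (1 + t z)^-1).
    by have := derive_quotient dn dc (cn0 z Hz) w; rewrite dcE dnE.
  have F2 w : 'D_w (snd \o st') z = 'D_w t z * (1 + t z)^-1
      - t z * 'D_w t z * ((1 + t z)^-1 * (1 + t z)^-1).
    by have := derive_quotient (dt z Hz) dc (cn0 z Hz) w; rewrite dcE.
  (* One identity for arbitrary directions serves all three conformality conditions, with the factor
     l divided by 1 + t. *)
  have metricE w w' : hessian_metric f' (st' z)
        ('D_w (fst \o st') z, 'D_w (snd \o st') z)
        ('D_w' (fst \o st') z, 'D_w' (snd \o st') z)
      = hessian_metric f (st z) ('D_w s z, 'D_w t z) ('D_w' s z, 'D_w' t z) / (1 + t z).
    rewrite /hessian_metric /= !F1 !F2 h11 h12 h22.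
    exact: perspective_metric (c0 z Hz).
  split; first exact: divr_gt0 l0 (c0 z Hz).
  - exact: etrans (metricE _ _) (congr1 (fun x => x / _) m11).
  - exact: etrans (metricE _ _) (congr1 (fun x => x / _) m22).
  - exact: etrans (metricE _ _) (etrans (congr1 (fun x => x / _) m12) (mul0r _)).
split.
- split; first exact: slope_map_image.
  move=> p Np q p'; have [_ fin _ _] := sT; have [_ fin' _ _] := sT'.
  have t1 : 0 < 1 + p.2 by case/newton_lozengeE: (Np); lra.
  have p'E : p' = p by exact: slope_mapK.
  have qE : 1 - q.2 = (1 + p.2)^-1 by rewrite /q /slope_map /=; field; rewrite gt_eqF.
  rewrite p'E qE; suff E : sigma' q = ((1 + p.2)^-1%:E * sigma p)%E by [].
  rewrite -(fineK (fin' _ (slope_map_newton Np))) -(fineK (fin _ Np)) -EFinM.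
  by rewrite (surface_tension_slope_map r1 sT sT' Np) mulrC.
- by [].
have sqrtE z : H z -> Num.sqrt (kappa f' (st' z)) = Num.sqrt pi * (1 + t z).
  move=> Hz; rewrite kappaE // sqrtrM ?pi_ge0 // sqrtr_sqr ger0_norm // ltW //.
  exact: c0.
have harm : harmonic_on H (fun z => Num.sqrt (kappa f' (st' z))).
  have dc (a : R) z : differentiable (fun _ : R * R => a) z by exact: differentiable_cst.
  (* On H the function equals [g], affine in t, so its Laplacian is a multiple of that of t. *)
  pose g z := Num.sqrt pi * (1 + t z).
  have gE z : H z -> Num.sqrt (kappa f' (st' z)) = g z := sqrtE z.
  have C k c : Ck_on k H (fun _ : R * R => c) := Ck_on_cst k H c.
  have Cg : Ck_on 2 H g by exact: (Ck_onM oH (C 2%N _) (Ck_onD oH (C 2%N 1) C2t)).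
  have g1 z : H z -> pd1 g z = Num.sqrt pi * pd1 t z.
    move=> Hz; rewrite (pd1M_fun (dc _ _) (differentiableD_fun (dc 1 z) (dt z Hz))).
    by rewrite (pd1D_fun (dc 1 z) (dt z Hz)) !(pd_cst _ _).1 mul0r !add0r.
  have g2 z : H z -> pd2 g z = Num.sqrt pi * pd2 t z.
    move=> Hz; rewrite (pd2M_fun (dc _ _) (differentiableD_fun (dc 1 z) (dt z Hz))).
    by rewrite (pd2D_fun (dc 1 z) (dt z Hz)) !(pd_cst _ _).2 mul0r !add0r.
  have d1t z : H z -> differentiable (pd1 t) z by have [_ [d _ _] _] := C2t; exact: d.
  have d2t z : H z -> differentiable (pd2 t) z by have [_ _ [d _ _]] := C2t; exact: d.
  split; first by apply: (Ck_on_eq oH _ Cg) => z Hz; exact: esym (gE z Hz).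
  move=> z Hz.
  have -> : pd1 (pd1 (fun z => Num.sqrt (kappa f' (st' z)))) z = Num.sqrt pi * pd1 (pd1 t) z.
    transitivity (pd1 (fun z => Num.sqrt pi * pd1 t z) z).
      apply: (pd1_eq_on oH Hz) => x Hx; rewrite -g1 //.
      exact: (pd1_eq_on oH Hx gE).
    by rewrite (pd1M_fun (dc _ _) (d1t z Hz)) (pd_cst _ _).1 mul0r add0r.
  have -> : pd2 (pd2 (fun z => Num.sqrt (kappa f' (st' z)))) z = Num.sqrt pi * pd2 (pd2 t) z.
    transitivity (pd2 (fun z => Num.sqrt pi * pd2 t z) z).
      apply: (pd2_eq_on oH Hz) => x Hx; rewrite -g2 //.
      exact: (pd2_eq_on oH Hx gE).
    by rewrite (pd2M_fun (dc _ _) (d2t z Hz)) (pd_cst _ _).2 mul0r add0r.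
  by rewrite -mulrDr lapt // mulr0.
split; [exact: sqrtE|exact: harm|].
by exists H, st'; split; [exact: coord|exact: harm].
Qed.
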